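(* Let $t_0\in\mathbb{R}$, let $b_0,b_1,b_2\in\mathbb{R}$, and let $\mathbb{P}(x_0,x_1,x_2,x_3)=\sum_{|\boldsymbol{\alpha}|=0}^{4}\Omega_{\boldsymbol{\alpha}}(x_0)\,x_1^{\alpha_1}x_2^{\alpha_2}x_3^{\alpha_3}$ be a polynomial of degree four in $(x_1,x_2,x_3)$ whose coefficients $\Omega_{\boldsymbol{\alpha}}$ are real-valued functions of $x_0$. Consider the equation $$z'''(t)+b_2z''(t)+b_1z'(t)+b_0z(t)=\mathbb{P}(t,z(t),z'(t),z''(t)).\qquad ( * )$$ Let $p\in]1,\infty]$ and assume: $(P_1)$ The roots $\gamma_1,\gamma_2,\gamma_3$ of the characteristic polynomial of $z'''+b_2z''+b_1z'+b_0z=0$ are real and simple, and $\gamma_1>\gamma_2>\gamma_3$. $(P_2)$ With $\mathcal{G}$ and $\mathcal{L}$ as in the context, as $t\to\infty$: $\mathcal{G}\big(\sum_{|\boldsymbol{\alpha}|=0}\Omega_{\boldsymbol{\alpha}}\big)(t)\to0$, $\mathcal{L}\big(\sum_{|\boldsymbol{\alpha}|=1}|\Omega_{\boldsymbol{\alpha}}|\big)(t)\to0$, and $\sum_{k=1}^4\mathcal{L}\big(\sum_{|\boldsymbol{\alpha}|=k}^{4}|\Omega_{\boldsymbol{\alpha}}|\big)(t)$ is bounded. (Smallness) For some admissible $\beta$ and some $\rho\in\big]0,\frac{1}{\varsigma\hat A}\big[$, with $\varsigma$ and $\hat A$ as in the context, $\sum_{|\boldsymbol{\alpha}|=1}^{4}|\Omega_{\boldsymbol{\alpha}}(s)|\le\rho$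 for all $s\ge t_0$. $(P_3)$ $\Omega_{\boldsymbol{\alpha}}\in L^p([t_0,\infty[)$ for $|\boldsymbol{\alpha}|=0$, and for $|\boldsymbol{\alpha}|\ge1$ one has $\Omega_{\boldsymbol{\alpha}}(t)=\lambda_{\boldsymbol{\alpha},p}\Omega_{\boldsymbol{\alpha},p}(t)+\lambda_{\boldsymbol{\alpha},c}$, where $\lambda_{\boldsymbol{\alpha},p},\lambda_{\boldsymbol{\alpha},c}$ are real constants and $\Omega_{\boldsymbol{\alpha},p}\in L^p([t_0,\infty[)$. Then the solution $z\in C_0^2([t_0,\infty[)$ of $( * )$ satisfies: (i) $z\in W^{2,p}([t_0,\infty[)$. (ii) Let $m=\lceil p\rceil-1$ if $p\in]1,4]$ and $m=4$ if $p\in]4,\infty]$. There exist $m+1$ functions $\Theta_1,\ldots,\Theta_m$ and $\Psi$ such that $\Theta_k\in W^{2,p/k}([t_0,\infty[)$ for $k=1,\ldots,m$, $\Psi\in W^{2,1}([t_0,\infty[)$, and $$z^{(\ell)}(t)=\sum_{k=1}^m\Theta_k^{(\ell)}(t)+\Psi^{(\ell)}(t)\qquad\text{for }\ell=0,1,2.$$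
   Context: Multi-indices: $\boldsymbol{\alpha}=(\alpha_1,\alpha_2,\alpha_3)\in\{0,1,2,3,4\}^3$, $|\boldsymbol{\alpha}|=\alpha_1+\alpha_2+\alpha_3$; $\sum_{|\boldsymbol{\alpha}|=k}$ is the sum over multi-indices with $|\boldsymbol{\alpha}|=k$, and $\sum_{|\boldsymbol{\alpha}|=k}^{4}$ the sum over those with $k\le|\boldsymbol{\alpha}|\le4$. Ceiling: $\lceil x\rceil=n+1$ for $x\in]n,n+1]$, $n\in\mathbb{Z}$. Spaces: $W^{2,p}([t_0,\infty[)=\{u\in L^p([t_0,\infty[): u',u''\in L^p([t_0,\infty[)\}$; $C_0^2([t_0,\infty[)=\{z\in C^2([t_0,\infty[,\mathbb{R}) : z,z',z''\to0 \text{ when } t\to\infty\}$. ''The solution'' of $( * )$ is its solution in $C_0^2([t_0,\infty[)$, which the paper asserts exists and is unique under $(P_1)$ and $(P_2)$. Sign classes: $\mathbb{R}^3_{---}$, $\mathbb{R}^3_{+--}$, $\mathbb{R}^3_{++-}$, $\mathbb{R}^3_{+++}$ denote the sets of triples in $\mathbb{R}^3$ whose first, second and third components have the indicated strict signs; $(\gamma_1,\gamma_2,\gamma_3)$ is assumed to lie in one of them. Constants: $\beta$ is admissible if $\beta\in]\gamma_1,0[$, $]\gamma_2,0[$, $]\gamma_3,0[$, $]0,\gamma_3[$ when $(\gamma_1,\gamma_2,\gamma_3)$ lies in $\mathbb{R}^3_{---}$, $\mathbb{R}^3_{+--}$, $\mathbb{R}^3_{++-}$, $\mathbb{R}^3_{+++}$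 respectively, and then respectively $$\varsigma=\frac{1}{\beta-\gamma_1},\quad \varsigma=\frac1{\gamma_1-\beta}+\frac1{\beta-\gamma_2},\quad \varsigma=\frac1{\gamma_2-\beta}+\frac1{\beta-\gamma_3},\quad \varsigma=\frac1{\gamma_3-\beta}.$$ Also $\hat A=\dfrac{A}{|(\gamma_2-\gamma_1)(\gamma_3-\gamma_2)(\gamma_3-\gamma_1)|}$ with $A=|\gamma_3-\gamma_2|(1+|\gamma_1|+|\gamma_1|^2)+|\gamma_3-\gamma_1|(1+|\gamma_2|+|\gamma_2|^2)+|\gamma_2-\gamma_1|(1+|\gamma_3|+|\gamma_3|^2)$. The function $g$: $$g(t,s)=\frac{1}{(\gamma_3-\gamma_2)(\gamma_3-\gamma_1)(\gamma_2-\gamma_1)}\,g_j(t,s),$$ with $j=1,2,3,4$ according as $(\gamma_1,\gamma_2,\gamma_3)$ is in $\mathbb{R}^3_{---}$, $\mathbb{R}^3_{+--}$, $\mathbb{R}^3_{++-}$, $\mathbb{R}^3_{+++}$, where (values on $t=s$ are immaterial) - $g_1(t,s)=0$ for $t>s$, and $g_1(t,s)=(\gamma_2-\gamma_3)e^{-\gamma_1(t-s)}+(\gamma_3-\gamma_1)e^{-\gamma_2(t-s)}+(\gamma_1-\gamma_2)e^{-\gamma_3(t-s)}$ for $t<s$; - $g_2(t,s)=(\gamma_2-\gamma_3)e^{-\gamma_1(t-s)}$ for $t>s$, and $g_2(t,s)=(\gamma_1-\gamma_2)e^{-\gamma_3(t-s)}+(\gamma_3-\gamma_1)e^{-\gamma_2(t-s)}$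 for $t<s$; - $g_3(t,s)=(\gamma_2-\gamma_3)e^{-\gamma_1(t-s)}+(\gamma_3-\gamma_1)e^{-\gamma_2(t-s)}$ for $t>s$, and $g_3(t,s)=(\gamma_2-\gamma_1)e^{-\gamma_3(t-s)}$ for $t<s$; - $g_4(t,s)=(\gamma_2-\gamma_3)e^{-\gamma_1(t-s)}+(\gamma_3-\gamma_1)e^{-\gamma_2(t-s)}+(\gamma_1-\gamma_2)e^{-\gamma_3(t-s)}$ for $t>s$, and $g_4(t,s)=0$ for $t<s$. Functionals, for a function $E$ on $[t_0,\infty[$: $$\mathcal{G}(E)(t)=\Big|\int_{t_0}^\infty g(t,s)E(s)ds\Big|+\Big|\int_{t_0}^\infty \frac{\partial g}{\partial t}(t,s)E(s)ds\Big|+\Big|\int_{t_0}^\infty \frac{\partial^2 g}{\partial t^2}(t,s)E(s)ds\Big|,$$ $$\mathcal{L}(E)(t)=\int_{t_0}^\infty\Big[|g(t,s)|+\Big|\frac{\partial g}{\partial t}(t,s)\Big|+\Big|\frac{\partial^2 g}{\partial t^2}(t,s)\Big|\Big]|E(s)|ds.$$ *)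

(* Defs.v *)
From HB Require Import structures.
From mathcomp Require Import all_boot all_order all_algebra.
From mathcomp Require Import all_classical all_reals all_analysis.

Set Implicit Arguments.
Unset Strict Implicit.
Unset Printing Implicit Defensive.

Import Order.TTheory GRing.Theory Num.Theory.
Import numFieldNormedType.Exports.

Local Open Scope classical_set_scope.
Local Open Scope ring_scope.

(* Functions on [t0, +oo[ are represented by functions R -> R; nothing below  *)
(* depends on their values at the left of t0.                                 *)
Section functions_on_halfline.
Context {R : realType}.
Implicit Types (t : R) (f u z : R -> R) (p : \bar R).

Local Notation mu := (@lebesgue_measure R).

(* The limit is taken inside [t0, +oo[: the derivative is two-sided for       *)
(* t > t0 and one-sided at t0.                                                *)
Definition diff_quot_filter (t0 : R) f t :=
  (f s - f t) / (s - t) @[s --> within `[t0, +oo[ t^'].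

Definition derivable_on (t0 : R) f := forall t, t0 <= t -> cvg (diff_quot_filter t0 f t).

Definition deriv_on (t0 : R) f : R -> R := fun t => lim (diff_quot_filter t0 f t).

Definition derivn_on (t0 : R) (l : nat) f : R -> R := iter l (deriv_on t0) f.

(* Local absolute continuity on [t0, +oo[, in Lebesgue's form: f is the       *)
(* indefinite integral of its locally integrable a.e. derivative.             *)
Definition loc_AC (t0 : R) f :=
  forall T, t0 <= T ->
    mu.-integrable `[t0, T] (EFin \o deriv_on t0 f) /\
    f T - f t0 = \int[mu]_(s in `[t0, T]) deriv_on t0 f s.

Definition Lp (t0 : R) p : set (R -> R) :=
  [set f | f \_ `[t0, +oo[ \in Lfun mu p].

(* u' and u'' are the generalized derivatives (u and u' are locally           *)
(* absolutely continuous, u'' is defined a.e.).                               *)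
Definition W2p (t0 : R) p : set (R -> R) :=
  [set u | [/\ loc_AC t0 u, loc_AC t0 (derivn_on t0 1 u) &
    forall l, (l <= 2)%N -> Lp t0 p (derivn_on t0 l u)]].

Definition C02 (t0 : R) : set (R -> R) :=
  [set z | [/\ derivable_on t0 z, derivable_on t0 (derivn_on t0 1 z),
    {within `[t0, +oo[, continuous (derivn_on t0 2 z)} &
    forall l, (l <= 2)%N -> derivn_on t0 l z t @[t --> +oo] --> 0]].

End functions_on_halfline.

(* A multi-index assigns to i = 0, 1, 2 the exponent of z, z', z''.           *)
Definition multi_index := {ffun 'I_3 -> 'I_5}.

Definition mi_deg (a : multi_index) : nat := (\sum_(i < 3) a i)%N.

Section equation.
Context {R : realType}.
Implicit Types (t : R) (z : R -> R) (Omega : multi_index -> R -> R).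

Local Notation mu := (@lebesgue_measure R).

Definition poly_rhs Omega (t : R) (x : 'I_3 -> R) : R :=
  \sum_(a : multi_index | (mi_deg a <= 4)%N)
    Omega a t * \prod_(i < 3) x i ^+ a i.

(* The coefficients are only L^p-type functions, so the equation is           *)
(* understood in the sense of Caratheodory: z'' is locally absolutely         *)
(* continuous and the equation holds almost everywhere.                       *)
Definition ode_solution (t0 b0 b1 b2 : R) Omega z :=
  loc_AC t0 (derivn_on t0 2 z) /\
  {ae mu, forall t, t0 <= t ->
    derivn_on t0 3 z t + b2 * derivn_on t0 2 z t + b1 * derivn_on t0 1 z t
      + b0 * z t
    = poly_rhs Omega t (fun i => derivn_on t0 i z t)}.

Definition char_poly3 (b0 b1 b2 : R) : {poly R} :=
  'X^3 + b2 *: 'X^2 + b1 *: 'X + b0%:P.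

Definition abs_sum_from Omega (k : nat) (t : R) : R :=
  \sum_(a : multi_index | (k <= mi_deg a <= 4)%N) `|Omega a t|.

End equation.

Variant sign_class := MMM | PMM | PPM | PPP.

Section constants_and_kernel.
Context {R : realType}.
Variables (c : sign_class) (g1 g2 g3 : R).

Local Notation mu := (@lebesgue_measure R).

Definition in_sign_class : Prop :=
  match c with
  | MMM => [/\ g1 < 0, g2 < 0 & g3 < 0]
  | PMM => [/\ 0 < g1, g2 < 0 & g3 < 0]
  | PPM => [/\ 0 < g1, 0 < g2 & g3 < 0]
  | PPP => [/\ 0 < g1, 0 < g2 & 0 < g3]
  end.

Definition admissible (beta : R) : Prop :=
  match c with
  | MMM => g1 < beta < 0
  | PMM => g2 < beta < 0
  | PPM => g3 < beta < 0
  | PPP => 0 < beta < g3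
  end.

Definition varsigma (beta : R) : R :=
  match c with
  | MMM => (beta - g1)^-1
  | PMM => (g1 - beta)^-1 + (beta - g2)^-1
  | PPM => (g2 - beta)^-1 + (beta - g3)^-1
  | PPP => (g3 - beta)^-1
  end.

Definition A_const : R :=
  `|g3 - g2| * (1 + `|g1| + `|g1| ^+ 2)
  + `|g3 - g1| * (1 + `|g2| + `|g2| ^+ 2)
  + `|g2 - g1| * (1 + `|g3| + `|g3| ^+ 2).

Definition A_hat : R := A_const / `|(g2 - g1) * (g3 - g2) * (g3 - g1)|.

(* The value on the diagonal t = s is irrelevant.                             *)
Definition green_num (t s : R) : R :=
  let e1 := expR (- g1 * (t - s)) in
  let e2 := expR (- g2 * (t - s)) in
  let e3 := expR (- g3 * (t - s)) in
  match c with
  | MMM => if s < t then 0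
           else (g2 - g3) * e1 + (g3 - g1) * e2 + (g1 - g2) * e3
  | PMM => if s < t then (g2 - g3) * e1
           else (g1 - g2) * e3 + (g3 - g1) * e2
  | PPM => if s < t then (g2 - g3) * e1 + (g3 - g1) * e2
           else (g2 - g1) * e3
  | PPP => if s < t then (g2 - g3) * e1 + (g3 - g1) * e2 + (g1 - g2) * e3
           else 0
  end.

Definition green (t s : R) : R :=
  ((g3 - g2) * (g3 - g1) * (g2 - g1))^-1 * green_num t s.

Definition dgreen (l : nat) (t s : R) : R := derive1n l (green ^~ s) t.

Definition Gcal (t0 : R) (E : R -> R) (t : R) : R :=
  \sum_(l < 3) `|\int[mu]_(s in `[t0, +oo[) (dgreen l t s * E s)|.

Definition Lcal (t0 : R) (E : R -> R) (t : R) : \bar R :=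
  (\int[mu]_(s in `[t0, +oo[)
    ((\sum_(l < 3) `|dgreen l t s|) * `|E s|)%R%:E)%E.

End constants_and_kernel.

Definition num_terms {R : realType} (p : \bar R) : nat :=
  if (p <= 4%:R%:E)%E then (absz (Num.ceil (fine p))).-1 else 4.

(* Main.v *)
Require Import Defs.
From HB Require Import structures.
From mathcomp Require Import all_boot all_order all_algebra.
From mathcomp Require Import all_classical all_reals all_analysis.
From mathcomp Require Import measurable_realfun ess_sup_inf ring lra.

(* Write the equation as (D - gamma1)(D - gamma2)(D - gamma3) z = f, that is as
   a chain of three equations v' = gamma v + f on the half-line. For a bounded
   v, the L^q norm of v is controlled by that of f: if U solves the same
   equation with source |f|^q, then x <= l + l^(1-q) x^q and the maximum
   principle give |v| <= C l + l^(1-q) U for all l > 0, hence |v|^q <= C U, and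
   U is integrable by integrating its equation.

   For p = oo the function z itself is a decomposition. For p < oo, the
   hypothesis Lcal(sum_{|a|=1} |Omega_a|) -> 0 forces the constant parts of the
   coefficients of degree 1 to vanish, so that these lie in L^p. The terms of
   degree <= 1 of f are then in L^p since z is bounded, while those of higher
   degree are o(|z| + |z'| + |z''|) and are absorbed; this is (i). Consequently
   f = F_1 + ... + F_4 with F_k in L^(p/k), and F_k in L^1 if k >= p. Let Theta_k,
   k < p, be a bounded solution with source F_k; Psi is the remainder.

   The kernel g is never used to represent z, but only bounded from below in
   the study of Lcal: for the stated sign conventions it is the Green function
   of the equation with characteristic roots -gamma_i. *)

Set Implicit Arguments.
Unset Strict Implicit.
Unset Printing Implicit Defensive.

Import Order.TTheory GRing.Theory Num.Theory.
Import numFieldNormedType.Exports.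

Local Open Scope classical_set_scope.
Local Open Scope ring_scope.

(** * Indefinite integrals on a half-line *)

Section primitives.
Context {R : realType}.
Local Notation mu := (@lebesgue_measure R).
Implicit Types (a b c s t x : R) (f g h k : R -> R).

(** The L^q estimate for v' = gamma v + f must include q = 1, since Psi has to lie in L^1;
    comparison with U covers all q >= 1 at once. It is an a priori estimate: boundedness of v
    controls the end values, and for gamma > 0, where comparison runs backwards from the right end
    point, it excludes the growing exponential. All bounds are proved on [a, T] with constants
    independent of T. There the integrals are finite, so the part of the source that is small
    relative to z, z', z'' can be moved to the left-hand side before T tends to infinity. The
    constant parts of the coefficients are harmless in degree >= 2, where the monomial itself is
    small relative to z, z', z''. In degree 1 a constant times z is neither known to be in L^p nor
    relatively small, hence the detour through the kernel. The number of terms reflects the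
    condition p / k >= 1: the first-order estimate makes sense for the source F_k exactly in that
    range, and beyond it boundedness already puts F_k into L^1. *)

Definition itv_integrable a b f : Prop := mu.-integrable `[a, b] (EFin \o f).

Local Notation "'I_' a b f" := (\int[mu]_(s in `[a, b]) f s)
  (at level 10, a, b, f at level 9).

Lemma itv_integrableW a b a' b' f : a <= a' -> b' <= b -> itv_integrable a b f ->
  itv_integrable a' b' f.
Proof.
move=> aa bb; apply: integrableS => //; apply: subset_itv; rewrite bnd_simp//.
Qed.

Lemma itv_integrableD a b f g : itv_integrable a b f -> itv_integrable a b g ->
  itv_integrable a b (fun x => f x + g x).
Proof. by move=> fi gi; exact: (integrableD _ fi gi). Qed.

Lemma itv_integrableZ a b c f : itv_integrable a b f ->
  itv_integrable a b (fun x => c * f x).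
Proof. by move=> fi; exact: (integrableZl _ c fi). Qed.

Lemma eq_itv_integrable a b f g : (forall x, a <= x <= b -> f x = g x) ->
  itv_integrable a b f -> itv_integrable a b g.
Proof.
move=> fg; apply: eq_integrable => // x; rewrite inE/= in_itv/= => xab.
by rewrite fg.
Qed.

Lemma eq_itv_integral a b f g : (forall x, a <= x <= b -> f x = g x) ->
  I_ a b f = I_ a b g.
Proof.
by move=> fg; apply: eq_Rintegral => x; rewrite inE/= in_itv/= => /fg.
Qed.

Lemma le_itv_integral a b f g : itv_integrable a b f -> itv_integrable a b g ->
  (forall x, a <= x <= b -> f x <= g x) -> I_ a b f <= I_ a b g.
Proof.
by move=> fi gi fg; apply: le_Rintegral => // x; rewrite /= in_itv/= => /fg.
Qed.

Lemma itv_integral_cst a b c : a <= b -> I_ a b (fun=> c) = c * (b - a).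
Proof.
by move=> ab; rewrite Rintegral_cst//= lebesgue_measure_itv/= lte_fin;
  case: ltP => // ba; have -> : a = b by [lra]; rewrite subrr.
Qed.

Lemma itv_integrable_cst a b c : itv_integrable a b (fun=> c).
Proof.
apply: continuous_compact_integrable; first exact: segment_compact.
by apply: continuous_subspaceT => x; exact: cvg_cst.
Qed.

Lemma itv_integral_split a b x f : a <= x -> x <= b -> itv_integrable a b f ->
  I_ a b f = I_ a x f + I_ x b f.
Proof.
move=> ax xb fi.
have := @Rintegral_itvB R f (BLeft a) (BRight b) x fi.
rewrite !bnd_simp => /(_ ax xb) /eqP; rewrite subr_eq => /eqP ->.
rewrite addrC; congr (_ + _); apply: Rintegral_itv_obnd_cbnd.
by apply: integrableS fi => //; apply: subset_itv; rewrite bnd_simp.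
Qed.

Lemma norm_itv_integral_le a b f : itv_integrable a b f ->
  `|I_ a b f| <= I_ a b (fun x => `|f x|).
Proof. by move=> fi; exact: le_normr_Rintegral. Qed.

Lemma itv_integrable_norm a b f : itv_integrable a b f ->
  itv_integrable a b (fun x => `|f x|).
Proof. by move=> fi; exact: integrable_norm. Qed.

Lemma itv_integralD a b f g : itv_integrable a b f -> itv_integrable a b g ->
  I_ a b (fun x => f x + g x) = I_ a b f + I_ a b g.
Proof. by move=> fi gi; exact: RintegralD. Qed.

Lemma itv_integralZ a b c f : itv_integrable a b f ->
  I_ a b (fun x => c * f x) = c * I_ a b f.
Proof. by move=> fi; exact: RintegralZl. Qed.

Lemma itv_integral_point a f : I_ a a f = 0.
Proof. by rewrite set_itv1 Rintegral_set1. Qed.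

Lemma continuous_itv_integrable a b f : continuous f -> itv_integrable a b f.
Proof.
move=> cf; apply: continuous_compact_integrable; first exact: segment_compact.
by apply: continuous_subspaceT.
Qed.

Lemma continuous_bounded_itv a b f : continuous f ->
  exists2 M, 0 <= M & forall x, a <= x <= b -> `|f x| <= M.
Proof.
move=> cf.
have /compact_bounded : compact (f @` `[a, b]).
  by apply: continuous_compact; [exact: continuous_subspaceT|exact:
    segment_compact].
case=> M [_ HM]; exists (`|M| + 1) => [|x xab]; first by rewrite addr_ge0.
apply: (HM (`|M| + 1)); first by rewrite ltr_pwDr// ler_norm.
by exists x => //=; rewrite in_itv.
Qed.

Lemma itv_integrableM_bounded a b f g (M : R) : itv_integrable a b f ->
  measurable_fun `[a, b] g ->
  (forall x, a <= x <= b -> `|g x| <= M) -> itv_integrable a b (fun x => g x * f x).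
Proof.
move=> fi mg gM; have mab : measurable `[a, b]%classic by exact: measurable_itv.
have H : [bounded g x | x in `[a, b]%classic].
  exists `|M|; split; first exact: num_real.
  move=> N MN x /=; rewrite in_itv/= => /gM; move: (ler_norm M); lra.
exact: (@integrableMr _ _ R mu `[a, b]%classic mab g _ mg H fi).
Qed.

(* Continuity of f on [t0, +oo[, phrased as continuity on R of the extension
   of f that is constant on the left of t0. *)
Definition hcont t0 f := continuous (fun t => f (Num.max t0 t)).

(** Absolute continuity with a density h that matters only up to null sets. A first-order equation
    v' = gam v + f is encoded below as [prim a v (fun x => gam * v x + f x)], so that no pointwise
    derivative of v is required. *)
Definition prim t0 f h := (forall T, itv_integrable t0 T h) /\
  (forall t, t0 <= t -> f t = f t0 + I_ t0 t h).

Variable t0 : R.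

Lemma hcont_cst c : hcont t0 (fun=> c).
Proof. by move=> x; exact: cvg_cst. Qed.

Lemma hcontD f g : hcont t0 f -> hcont t0 g -> hcont t0 (fun x => f x + g x).
Proof. by move=> cf cg x; apply: cvgD; [exact: cf|exact: cg]. Qed.

Lemma hcontM f g : hcont t0 f -> hcont t0 g -> hcont t0 (fun x => f x * g x).
Proof. by move=> cf cg x; apply: cvgM; [exact: cf|exact: cg]. Qed.

Lemma hcontZ c f : hcont t0 f -> hcont t0 (fun x => c * f x).
Proof. by move=> cf; apply: hcontM => //; exact: hcont_cst. Qed.

Lemma maxr_id t : t0 <= t -> Num.max t0 t = t.
Proof. by move=> tt; apply/max_idPr. Qed.

Lemma continuous_maxr : continuous (fun t : R => Num.max t0 t).
Proof. by move=> x; apply: (@continuous_max _ _ (cst t0) id) => //;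
  exact: cvg_cst. Qed.

Lemma continuous_hcont f : continuous f -> hcont t0 f.
Proof.
by move=> cf x; apply: continuous_comp; [exact: continuous_maxr|exact: cf].
Qed.

Lemma hcont_eq f g : (forall t, t0 <= t -> f t = g t) -> hcont t0 f -> hcont t0 g.
Proof.
move=> fg; rewrite /hcont; set F := (X in continuous X -> _);
  set G := (X in _ -> continuous X).
suff -> : F = G by [].
by apply/funext => t; rewrite /F fg// le_max lexx.
Qed.

Lemma hcont_itv_integrable f a b : t0 <= a -> hcont t0 f -> itv_integrable a b f.
Proof.
move=> t0a /(@continuous_itv_integrable a b) fi;
  apply: eq_itv_integrable fi => x /andP[ax _].
by rewrite /= maxr_id// (le_trans t0a).
Qed.

Lemma hcont_bounded f b : hcont t0 f ->
  exists2 M, 0 <= M & forall x, t0 <= x <= b -> `|f x| <= M.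
Proof.
move=> /(@continuous_bounded_itv t0 b)[M M0 fM]; exists M => // x xb.
by have := fM _ xb; rewrite maxr_id//; case/andP: xb.
Qed.

Lemma hcont_measurable f : hcont t0 f -> measurable_fun `[t0, +oo[ f.
Proof.
move=> /continuous_measurable_fun cf.
apply: (eq_measurable_fun (fun t => f (Num.max t0 t))).
  by move=> x; rewrite inE/= in_itv/= andbT => t0x; rewrite maxr_id.
exact: measurable_funS cf.
Qed.

Lemma prim_itv_integrable f h a b : t0 <= a -> prim t0 f h -> itv_integrable a b h.
Proof. by move=> t0a [hi _]; apply: itv_integrableW (hi b). Qed.

Lemma prim_sub f h a b : prim t0 f h -> t0 <= a -> a <= b ->
  f b - f a = I_ a b h.
Proof.
move=> [hi fh] t0a ab; rewrite (fh b) ?(le_trans t0a)// (fh a)//.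
by rewrite (itv_integral_split t0a ab)//; ring.
Qed.

Lemma primD f g h k : prim t0 f h -> prim t0 g k ->
  prim t0 (fun x => f x + g x) (fun x => h x + k x).
Proof.
move=> [hi fh] [ki gk]; split=> [T|t t0t]; first exact: itv_integrableD.
by rewrite fh// gk// itv_integralD//; ring.
Qed.

Lemma primZ c f h : prim t0 f h -> prim t0 (fun x => c * f x) (fun x => c * h x).
Proof.
move=> [hi fh]; split=> [T|t t0t]; first exact: itv_integrableZ.
by rewrite fh// itv_integralZ//; ring.
Qed.

Lemma prim_cst c : prim t0 (fun=> c) (fun=> 0).
Proof.
split=> [T|t t0t]; first exact: itv_integrable_cst.
by rewrite itv_integral_cst// mul0r addr0.
Qed.

Lemma prim_eq f h f' h' : (forall t, t0 <= t -> f t = f' t) ->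
  (forall t, t0 <= t -> h t = h' t) -> prim t0 f h -> prim t0 f' h'.
Proof.
move=> ff hh [hi fh]; split=> [T|t t0t].
  by apply: eq_itv_integrable (hi T) => x /andP[/hh].
by rewrite -!ff// fh//; congr (_ + _); apply: eq_itv_integral => x /andP[/hh].
Qed.

Lemma hcontP f :
  (forall x, t0 <= x -> f @ within `[t0, +oo[ (nbhs x) --> f x) -> hcont t0 f.
Proof.
move=> cf x A /= nA.
have t0x : t0 <= Num.max t0 x by rewrite le_max lexx.
have wA := cf _ t0x A nA.
have H : \forall s \near x, Num.max t0 s \in `[t0, +oo[ -> A (f (Num.max t0 s)).
  exact: (@continuous_maxr x _ wA).
suff: \forall s \near x, A (f (Num.max t0 s)) by [].
by apply: filterS H => s; apply; rewrite in_itv/= andbT le_max lexx.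
Qed.

Lemma within_hcont f : {within `[t0, +oo[, continuous f} -> hcont t0 f.
Proof.
move=> /subspace_continuousP cf; apply: hcontP => x t0x; apply: cf.
by rewrite /= in_itv/= t0x.
Qed.

Lemma prim_hcont f h : prim t0 f h -> hcont t0 f.
Proof.
move=> [hi fh]; apply: hcontP => x t0x.
(* The interval reaches beyond x, so near x it coincides with the half-line. *)
have t0x1 : t0 <= x + 1 by lra.
have := parameterized_integral_continuous t0x1 (hi (x + 1)).
move=> /subspace_continuousP /(_ x); rewrite /= in_itv/= t0x lerDl ler01.
move=> /(_ isT) /(cvgD (cvg_cst (f t0))) cf.
have W A : within `[t0, x + 1] (nbhs x) A -> within `[t0, +oo[ (nbhs x) A.
  rewrite /within /=; apply: filter_app.
  have : \forall s \near x, s < x + 1 by apply: lt_nbhsl; lra.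
  apply: filterS => s s1 As; rewrite in_itv/= andbT => t0s.
  by apply: As; rewrite in_itv/= t0s ltW.
have cf2 : f t0 + I_ t0 s h @[s --> within `[t0, +oo[ (nbhs x)] --> f x.
  by rewrite (fh _ t0x); move=> A /cf /W.
apply: cvg_trans cf2; apply: near_eq_cvg.
have := withinT `[t0, +oo[%classic (nbhs_filter x); apply: filterS => s /=.
by rewrite in_itv/= andbT => /fh.
Qed.

(** Cutting [a, b] into n equal pieces, the bounds sum to K (b - a) / n times the total increment of
    N, because the increments of N telescope; this tends to 0. *)
Lemma no_increment (D N : R -> R) K a b : a <= b -> 
  (forall s t, a <= s -> s <= t -> t <= b ->
    `|D t - D s| <= K * (t - s) * (N t - N s)) -> D a = D b.
Proof.
move=> ab H.
suff Hn n : `|D b - D a| * n.+1%:R <= K * (b - a) * (N b - N a).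
  apply/eqP; rewrite eq_sym -subr_eq0 -normr_eq0; apply/negPn/negP => D0.
  have {}D0 : 0 < `|D b - D a| by rewrite lt_def D0 /=.
  pose n := Num.trunc (K * (b - a) * (N b - N a) / `|D b - D a|).
  have := Hn n; rewrite -ler_pdivlMl// mulrC leNgt; apply/negP; rewrite negbK.
  exact: truncnS_gt.
pose d := (b - a) / n.+1%:R.
have n0 : 0 < n.+1%:R :> R by rewrite ltr0n.
have d0 : 0 <= d by rewrite divr_ge0 ?subr_ge0// ltW.
pose x (i : nat) : R := a + i%:R * d.
have xn : x n.+1 = b by rewrite /x /d; field; rewrite addrC natr1 pnatr_eq0.
have xS i : x i.+1 = x i + d by rewrite /x -natr1; ring.
have xle i : (i <= n.+1)%N -> x i <= b.
  by move=> i_n; rewrite -xn /x lerD2l ler_wpM2r// ler_nat.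
have ax i : a <= x i by rewrite /x lerDl mulr_ge0.
have ind i : (i <= n.+1)%N -> `|D (x i) - D a| <= K * d * (N (x i) - N a).
  elim: i => [_|i ih i_n].
    by rewrite /x mul0r addr0 !subrr normr0 mulr0.
  have {}ih := ih (ltnW i_n).
  have := H (x i) (x i.+1) (ax i); rewrite (xle i.+1)// => /(_ _ isT).
  move: (xS i); set y := x i.+1; set u := x i in ih * => yE.
  have uy : u <= y by rewrite yE lerDl.
  have yu : y - u = d by rewrite yE; ring.
  rewrite yu => /(_ uy) H1.
  have -> : D y - D a = (D y - D u) + (D u - D a) by ring.
  by apply: (le_trans (ler_normD _ _)); apply: (le_trans (lerD H1 ih)); lra.
have := ind n.+1 (leqnn _); rewrite xn => H1.
rewrite -ler_pdivlMr//; apply: (le_trans H1); rewrite /d.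
by rewrite le_eqVlt; apply/orP; left; apply/eqP; field;
  rewrite addrC natr1 pnatr_eq0.
Qed.

End primitives.

Section primitives2.
Context {R : realType}.
Local Notation mu := (@lebesgue_measure R).
Implicit Types (a b c s t x : R) (f g h k : R -> R).
Local Notation "'I_' a b f" := (\int[mu]_(s in `[a, b]) f s)
  (at level 10, a, b, f at level 9).
Variable t0 : R.

(* Both primitives being merely absolutely continuous, the product rule is
   checked on increments: the defect over [s, u] is O(u - s) times the integral
   of |h|. *)
Lemma primM f g h k : prim t0 f h -> prim t0 g k -> hcont t0 k ->
  prim t0 (fun x => g x * f x) (fun x => k x * f x + g x * h x).
Proof.
move=> fh gk ck.
have cf := prim_hcont fh; have cg := prim_hcont gk.
have kfi a b : t0 <= a -> itv_integrable a b (fun x => k x * f x).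
  by move=> t0a; apply: (hcont_itv_integrable _ t0a); exact: (hcontM ck cf).
have ghi a b : t0 <= a -> itv_integrable a b (fun x => g x * h x).
  move=> t0a; have [M M0 gM] := hcont_bounded b cg.
  apply: (itv_integrableM_bounded (M := M)); first exact:
    (prim_itv_integrable b t0a fh).
    apply: measurable_funS (hcont_measurable cg) => //.
    by apply: subset_itv; rewrite bnd_simp.
  by move=> x /andP[ax xb]; apply: gM; rewrite xb (le_trans t0a).
have ti a b : t0 <= a -> itv_integrable a b (fun x => k x * f x + g x * h x).
  by move=> t0a; apply: itv_integrableD; [exact: kfi|exact: ghi].
split=> [T|t t0t]; first exact: ti.
have [K K0 kK] := hcont_bounded t ck.
have hi a b : t0 <= a -> itv_integrable a b h by move=> ?;
  exact: prim_itv_integrable fh.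
have ki a b : t0 <= a -> itv_integrable a b k by move=> ?;
  exact: prim_itv_integrable gk.
pose D s := g s * f s - I_ t0 s (fun x => k x * f x + g x * h x).
pose N s := I_ t0 s (fun x => `|h x|).
have : D t0 = D t.
  apply: (no_increment (D := D) (N := N) (K := K *+ 2)) => // s u t0s su ut.
  have t0u : t0 <= u by lra.
  have -> : N u - N s = I_ s u (fun x => `|h x|).
    have E (p q : R) : p + q - p = q by ring.
    by rewrite /N (itv_integral_split t0s su) ?E//; apply: itv_integrable_norm;
      exact: hi.
  set J := I_ s u (fun x => `|h x|).
  have J0 : 0 <= J by apply: Rintegral_ge0.
  have hki : itv_integrable s u (fun x => g u * h x + f s * k x).
    exact: (itv_integrableD (itv_integrableZ (g u) (hi s u t0s)) (itv_integrableZ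
      (f s) (ki s u t0s))).
  (* Discrete Leibniz rule: the increment of g f is g u times that of f plus f s times that of g.
     Freezing the coefficients at u and s costs K (u - s) in the first term and the integral of |h|
     in the second; each contributes once to the factor 2 K. *)
  have -> : D u - D s =
      I_ s u (fun x => (g u - g x) * h x + (f s - f x) * k x).
    have -> : I_ s u (fun x => (g u - g x) * h x + (f s - f x) * k x) =
        I_ s u (fun x => (g u * h x + f s * k x)
          + - 1 * (k x * f x + g x * h x)).
      by apply: eq_itv_integral => x _; ring.
    rewrite itv_integralD; [|exact: hki|exact: (itv_integrableZ (- 1) (ti s u
      t0s))].
    rewrite itv_integralZ; last exact: ti.
    rewrite itv_integralD; [|exact: (itv_integrableZ (g u) (hi s u t0s))|exact:
      (itv_integrableZ (f s) (ki s u t0s))].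
    rewrite itv_integralZ; last exact: hi.
    rewrite itv_integralZ; last exact: ki.
    rewrite -(prim_sub fh t0s su) -(prim_sub gk t0s su).
    rewrite /D (itv_integral_split t0s su); last exact: ti.
    by ring.
  have gx x : s <= x <= u -> `|g u - g x| <= K * (u - s).
    move=> /andP[sx xu]; have t0x : t0 <= x by lra.
    rewrite (prim_sub gk t0x xu); apply: (le_trans (norm_itv_integral_le _));
      first exact: ki.
    apply: (@le_trans _ _ (I_ x u (fun=> K))).
      apply: le_itv_integral; [exact: itv_integrable_norm (ki _ _ _)|exact:
        itv_integrable_cst|].
      by move=> y /andP[xy yu]; apply: kK; apply/andP; split; lra.
    by rewrite itv_integral_cst// ler_wpM2l// lerD2l lerN2.
  have fx x : s <= x <= u -> `|f s - f x| <= J.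
    move=> /andP[sx xu]; rewrite distrC (prim_sub fh t0s sx).
    apply: (le_trans (norm_itv_integral_le _)); first exact: hi.
    rewrite /J (itv_integral_split sx xu); last by apply: itv_integrable_norm;
      exact: hi.
    by rewrite lerDl; apply: Rintegral_ge0.
  have Ri : itv_integrable s u (fun x => (g u - g x) * h x + (f s - f x) * k x).
    apply: eq_itv_integrable (itv_integrableD hki (itv_integrableZ (- 1) (ti s u
      t0s))).
    by move=> x _; ring.
  have hn : itv_integrable s u (fun x => `|h x|) by exact:
    (itv_integrable_norm (hi s u t0s)).
  apply: (le_trans (norm_itv_integral_le Ri)).
  apply: (@le_trans _ _ (I_ s u (fun x => K * (u - s) * `|h x| + J * K))).
    apply: le_itv_integral; first exact: itv_integrable_norm.
      exact: (itv_integrableD (itv_integrableZ (K * (u - s)) hn)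
        (itv_integrable_cst _ _ _)).
    move=> x xsu; apply: (le_trans (ler_normD _ _)); rewrite !normrM.
    apply: lerD; first by apply: ler_wpM2r => //; exact: gx.
    apply: ler_pM => //; first exact: fx.
    by apply: kK; case/andP: xsu => *; apply/andP; split; lra.
  rewrite itv_integralD; [|exact: (itv_integrableZ (K * (u - s)) hn)|exact:
    itv_integrable_cst].
    rewrite itv_integralZ; last exact: hn.
  rewrite itv_integral_cst// -/J; lra.
rewrite /D itv_integral_point; lra.
Qed.

(** * Derivatives on the half-line and their relation to primitives *)

Local Notation has_deriv f t l := (diff_quot_filter t0 f t --> l).

(** The points to the right of t stay in the half-line, so limits of difference quotients are unique
    even at the end point t0. *)
Lemma within_right_proper t : t0 <= t -> ProperFilter (within `[t0, +oo[ t^').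
Proof.
move=> t0t; apply: Build_ProperFilter_ex => A wA.
have {wA} : \forall s \near t^'+, A s.
  have : \forall s \near t^', s \in `[t0, +oo[ -> A s by exact: wA.
  move=> H.
  have {}H : \forall s \near t, s != t -> s \in `[t0, +oo[ -> A s by exact: H.
  suff: \forall s \near t, t < s -> A s by [].
  apply: filterS H => s H ts; apply: H; first by rewrite gt_eqF.
  by rewrite in_itv/= (le_trans t0t)// ltW.
by move=> H; have [s As] := @filter_ex _ _ _ _ H; exists s.
Qed.

Lemma deriv_onE f t l : t0 <= t -> has_deriv f t l -> deriv_on t0 f t = l.
Proof.
move=> t0t fl; have FP := within_right_proper t0t.
have FF : ProperFilter (diff_quot_filter t0 f t) by exact: fmap_proper_filter.
by apply: cvg_lim fl.
Qed.

Lemma deriv_onP f t : derivable_on t0 f -> t0 <= t ->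
  has_deriv f t (deriv_on t0 f t).
Proof. by move=> df t0t; exact: df. Qed.

Lemma has_derivP f t l : has_deriv f t l <->
  forall e, 0 < e -> \forall s \near t, s != t -> t0 <= s ->
    `|l - (f s - f t) / (s - t)| <= e.
Proof.
split.
  move=> /cvgrPdist_le H e /H {}H.
  have : \forall s \near t, s != t -> s \in `[t0, +oo[ ->
    `|l - (f s - f t) / (s - t)| <= e by exact: H.
  by apply: filterS => s {}H st t0s; apply: H => //; rewrite in_itv/= t0s.
move=> H; apply/cvgrPdist_le => e /H {}H.
suff: \forall s \near t, s != t -> s \in `[t0, +oo[ ->
  `|l - (f s - f t) / (s - t)| <= e by [].
by apply: filterS H => s H st; rewrite in_itv/= andbT => t0s; exact: H.
Qed.

Lemma prim_has_deriv f h t : prim t0 f h -> hcont t0 h -> t0 <= t ->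
  has_deriv f t (h t).
Proof.
move=> fh ch t0t; apply/has_derivP => e e0.
have := ch t; rewrite /continuous_at maxr_id// => /cvgrPdist_le /(_ e e0).
move=> /nbhs_ballP[d /= d0 dh]; near=> s => st t0s.
have sd : `|s - t| < d.
  by rewrite distrC; near: s; exists d.
have hx x : Num.min s t <= x <= Num.max s t -> `|h x - h t| <= e.
  move=> /andP[sx xt].
  have t0x : t0 <= x by apply: le_trans sx; rewrite le_min t0s.
  have := dh x; rewrite maxr_id//= distrC; apply.
  rewrite /ball/= distrC.
  apply: le_lt_trans sd; rewrite ler_norml; move: sx xt.
  by rewrite ge_min le_max; case: (ger0P (s - t)) => ?; lra.
(* Stated for an ordered pair, so as to serve for s on either side of t. *)
have key a b : a <= b -> t0 <= a -> (a = t \/ b = t) -> Num.min s t = a ->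
    Num.max s t = b -> `|I_ a b h - h t * (b - a)| <= e * (b - a).
  move=> ab t0a _ mina maxb; rewrite -itv_integral_cst//.
  have hi : itv_integrable a b h by exact: prim_itv_integrable fh.
  have -> : I_ a b h - I_ a b (fun=> h t) = I_ a b (fun x => h x + - 1 * h t).
    rewrite itv_integralD//; last exact: itv_integrable_cst.
    by rewrite !itv_integral_cst//; ring.
  have hci : itv_integrable a b (fun x => h x + -1 * h t).
    by apply: itv_integrableD => //; exact: itv_integrable_cst.
  apply: (le_trans (norm_itv_integral_le hci)); rewrite -itv_integral_cst//.
  apply: le_itv_integral; [exact: itv_integrable_norm|exact: itv_integrable_cst|].
  move=> x xab; rewrite mulN1r; apply: hx; by rewrite mina maxb.
have st0 : s - t != 0 by rewrite subr_eq0.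
have -> : h t - (f s - f t) / (s - t) = (h t * (s - t) - (f s - f t)) / (s - t).
  by field.
rewrite normrM normfV ler_pdivrMr ?normr_gt0//.
have [ts|st'] := leP t s.
  rewrite (ger0_norm (x := s - t)) ?subr_ge0// distrC (prim_sub fh)//.
  by apply: key => //; [left|rewrite min_r|rewrite max_l].
rewrite (ltr0_norm (x := s - t)) ?subr_lt0//.
have -> : - (s - t) = t - s by ring.
have -> : h t * (s - t) - (f s - f t) = (f t - f s) - h t * (t - s) by ring.
rewrite (prim_sub fh) ?(ltW st')//.
by apply: key; rewrite ?(ltW st')//; [right|rewrite min_l// ltW|rewrite max_r//
  ltW].
Unshelve. all: by end_near. Qed.

Lemma derivable_hcont f : derivable_on t0 f -> hcont t0 f.
Proof.
move=> df; apply: hcontP => x t0x.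
have /has_derivP /(_ 1 ltr01) H := deriv_onP df t0x.
set l := deriv_on t0 f x in H.
apply/cvgrPdist_lt => e e0.
suff: \forall s \near x, s \in `[t0, +oo[ -> `|f x - f s| < e by [].
near=> s; rewrite in_itv/= andbT => t0s.
have [->|sx] := eqVneq s x; first by rewrite subrr normr0.
have : `|l - (f s - f x) / (s - x)| <= 1.
  have : s != x -> t0 <= s -> `|l - (f s - f x) / (s - x)| <= 1 by near: s.
  exact.
have sx0 : s - x != 0 by rewrite subr_eq0.
set q := (f s - f x) / (s - x) => Hq.
have -> : f x - f s = - (q * (s - x)) by rewrite /q; field.
have L1 : 0 < `|l| + 1 by rewrite ltr_pwDr.
have ql : `|q| <= `|l| + 1.
  by have := ler_normB l (l - q); rewrite opprB addrC subrK; lra.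
rewrite normrN normrM; apply: (@le_lt_trans _ _ ((`|l| + 1) * `|s - x|)).
  by apply: ler_wpM2r.
rewrite mulrC -ltr_pdivlMr// distrC; near: s.
by apply: (nbhsx_ballx x (e / (`|l| + 1))); rewrite divr_gt0.
Unshelve. all: by end_near. Qed.

Lemma derivable_prim f : derivable_on t0 f -> hcont t0 (deriv_on t0 f) ->
  prim t0 f (deriv_on t0 f).
Proof.
move=> df ch; set h := deriv_on t0 f in ch *.
have hi T : itv_integrable t0 T h by exact: hcont_itv_integrable.
split => // t; rewrite le_eqVlt => /predU1P[<-|t0t];
  first by rewrite itv_integral_point addr0.
pose F s := I_ t0 s h.
have Fh : prim t0 F h by split => // s _; rewrite /F itv_integral_point add0r.
(* Extended by its value at t0, f - F is continuous on the whole line and has derivative 0 on ]t0,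
   t[. The mean value theorem then applies, although at t0 the derivatives are only one-sided. *)
pose g s := f (Num.max t0 s) - F (Num.max t0 s).
have cg : continuous g.
  by move=> s; apply: cvgB; [exact: derivable_hcont|exact: (prim_hcont Fh)].
have dg x : x \in `]t0, t[ -> is_derive x 1 g (0 : R).
  rewrite in_itv/= => /andP[t0x xt].
  have /has_derivP H1 := deriv_onP df (ltW t0x).
  have /has_derivP H2 := prim_has_deriv Fh ch (ltW t0x).
  have H : h^-1 *: (g (h *: 1 + x) - g x) @[h --> 0^'] --> (0 : R).
    apply/cvgrPdist_le => e e0.
    have e2 : 0 < e / 2 by lra.
    have := H1 _ e2; have := H2 _ e2 => {}H2 {}H1.
    have t0s : \forall s \near x, t0 < s by exact: lt_nbhsr.
    have {}H : \forall s \near x, s != x -> `|(g s - g x) / (s - x)| <= e.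
      near=> s => sx.
      have t0s' : t0 <= s by apply: ltW; near: s.
      have A1 : `|deriv_on t0 f x - (f s - f x) / (s - x)| <= e / 2.
        have : s != x -> t0 <= s -> `|deriv_on t0 f x - (f s - f x) / (s - x)| <=
          e / 2 by near: s.
        exact.
      have A2 : `|h x - (F s - F x) / (s - x)| <= e / 2.
        have : s != x -> t0 <= s -> `|h x - (F s - F x) / (s - x)| <= e / 2 by
          near: s.
        exact.
      rewrite /g !maxr_id ?(ltW t0x)//.
      have -> : (f s - F s - (f x - F x)) / (s - x) =
        (h x - (F s - F x) / (s - x)) - (deriv_on t0 f x - (f s - f x) / (s - x)).
        by rewrite /h; field; rewrite subr_eq0.
      by apply: (le_trans (ler_normB _ _)); lra.
    have {}H : \forall y \near 0, y != 0 -> `|(g (y + x) - g x) / y| <= e.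
      have : (y + x) @[y --> 0] --> x.
        by rewrite -[X in _ --> X]add0r; apply: cvgD;
          [exact: cvg_id|exact: cvg_cst].
      move=> /(_ _ H) {}H.
      have : \forall y \near 0, y + x != x -> `|(g (y + x) - g x) / (y + x - x)|
        <= e by exact: H.
      by apply: filterS => y; rewrite addrK -subr_eq0 addrK.
    suff: \forall y \near (0 : R), y != 0 -> `|0 - y^-1 *: (g (y *:
      1 + x) - g x)| <= e by [].
    near=> y => y0.
    rewrite sub0r normrN /GRing.scale/= mulr1 mulrC.
    have : y != 0 -> `|(g (y + x) - g x) / y| <= e by near: y.
    exact.
  apply: DeriveDef; first by apply/cvg_ex; exists 0; exact: H.
  by apply: cvg_lim.
have [c _] := MVT t0t dg (continuous_subspaceT cg).
rewrite mul0r /g !maxr_id ?lexx ?(ltW t0t)// /F itv_integral_point; lra.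
Unshelve. all: by end_near. Qed.

Lemma C02_prim z : C02 t0 z ->
  [/\ prim t0 z (derivn_on t0 1 z), prim t0 (derivn_on t0 1 z) (derivn_on t0 2 z)
    & hcont t0 (derivn_on t0 2 z)].
Proof.
move=> [dz dz1 /within_hcont cz2 _].
split => //; last exact: derivable_prim.
by apply: derivable_prim => //; exact: derivable_hcont dz1.
Qed.

Lemma prim_deriv_on f h t : prim t0 f h -> hcont t0 h -> t0 <= t ->
  deriv_on t0 f t = h t.
Proof. by move=> fh ch t0t; apply: deriv_onE => //; exact: prim_has_deriv. Qed.

Lemma prim_loc_AC f h : prim t0 f h -> hcont t0 h -> loc_AC t0 f.
Proof.
move=> fh ch T t0T; split.
  have hi : itv_integrable t0 T h by case: fh.
  apply: eq_itv_integrable hi => x /andP[t0x _].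
  by rewrite (prim_deriv_on fh).
rewrite (prim_sub fh)//; apply: eq_itv_integral => x /andP[t0x _].
by rewrite (prim_deriv_on fh).
Qed.

End primitives2.

(** * First-order equations *)

Section first_order.
Context {R : realType}.
Local Notation mu := (@lebesgue_measure R).
Implicit Types (a b c s t x : R) (f g h k : R -> R).
Local Notation "'I_' a b f" := (\int[mu]_(s in `[a, b]) f s)
  (at level 10, a, b, f at level 9).

Lemma bounded_itv_integrable a b g (M : R) : measurable_fun `[a, b] g ->
  (forall x, a <= x <= b -> `|g x| <= M) -> itv_integrable a b g.
Proof.
move=> mg gM; apply: eq_itv_integrable (itv_integrableM_bounded
  (itv_integrable_cst a b 1) mg gM) => x _ /=.
by rewrite mulr1.
Qed.

Lemma prim_shift t0 a f h : t0 <= a -> prim t0 f h -> prim a f h.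
Proof.
move=> t0a fh; split=> [T|t at_]; first exact: (prim_itv_integrable T t0a fh).
by rewrite -(prim_sub fh t0a at_); ring.
Qed.

Lemma hcont_expR t0 c : hcont t0 (fun x => expR (c * x)).
Proof.
apply: continuous_hcont => x; apply: continuous_comp; last exact: continuous_expR.
by apply: cvgM; [exact: cvg_cst|exact: cvg_id].
Qed.

Lemma is_derive_has_deriv t0 f t l : is_derive t 1 f l ->
  diff_quot_filter t0 f t --> l.
Proof.
move=> [df <-]; apply/has_derivP => e e0.
move: df => /cvgrPdist_le /(_ e e0) H.
have {}H : \forall y \near (0 : R), y != 0 ->
    `|'D_1 f t - y^-1 *: (f (y *: 1 + t) - f t)| <= e by exact: H.
have : (s - t) @[s --> t] --> (0 : R).
  by rewrite -(subrr t); apply: cvgB; [exact: cvg_id|exact: cvg_cst].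
move=> /(_ _ H) {}H.
have : \forall s \near t, s - t != 0 ->
    `|'D_1 f t - (s - t)^-1 *: (f ((s - t) *: 1 + t) - f t)| <= e by exact: H.
apply: filterS => s {}H st _.
have := H; rewrite subr_eq0 => /(_ st).
by rewrite /GRing.scale/= mulr1 subrK mulrC.
Qed.

Lemma prim_expR t0 c : prim t0 (fun x => expR (c * x)) (fun x => c * expR (c * x)).
Proof.
have H t : diff_quot_filter t0 (fun x => expR (c * x)) t --> c * expR (c * t).
  apply: is_derive_has_deriv.
  have E : is_derive t 1 (fun x => c * x) (c : R).
    have : is_derive t 1 (c \*: (@id R)) (c *: 1) by exact: is_deriveZ.
    by rewrite /GRing.scale/= mulr1.
  have := @is_derive1_comp R expR (fun x => c * x) t _ _ _ E.
  by move=> /(_ (expR (c * t))) H; rewrite mulrC; apply: H; exact: is_derive_expR.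
have dE t : t0 <= t -> deriv_on t0 (fun x => expR (c * x)) t = c * expR (c * t).
  by move=> t0t; exact: deriv_onE.
have ch : hcont t0 (deriv_on t0 (fun x => expR (c * x))).
  apply: (hcont_eq (f := fun x => c * expR (c * x))); first by move=> t /dE.
  by apply: hcontZ; exact: hcont_expR.
apply: prim_eq (derivable_prim _ ch) => // t t0t.
by apply/cvg_ex; exists (c * expR (c * t)); exact: H.
Qed.

Lemma prim_expM t0 c f h : prim t0 f h ->
  prim t0 (fun x => expR (c * x) * f x)
    (fun x => c * expR (c * x) * f x + expR (c * x) * h x).
Proof.
move=> fh; apply: primM => //; first exact: prim_expR.
by apply: hcontZ; exact: hcont_expR.
Qed.

Lemma integrating_factor t0 c f g : prim t0 f (fun x => c * f x + g x) ->
  prim t0 (fun x => expR (- c * x) * f x) (fun x => expR (- c * x) * g x).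
Proof.
move=> /(@prim_expM _ (- c)); apply: prim_eq => // t _; ring.
Qed.

(** The maximum principle for first-order equations: exp(- c x) f(x) is nondecreasing where g >= 0.
    In the backward version it is nonincreasing, and positivity travels from b to the left. *)
Lemma positivity_fwd a b c f g : prim a f (fun x => c * f x + g x) ->
  (forall x, a <= x <= b -> 0 <= g x) -> 0 <= f a ->
  forall t, a <= t <= b -> 0 <= f t.
Proof.
move=> /integrating_factor fg g0 fa t /andP[at_ tb].
have := prim_sub fg (lexx a) at_.
have : 0 <= I_ a t (fun x => expR (- c * x) * g x).
  apply: Rintegral_ge0 => x /=; rewrite in_itv/= => /andP[ax xt].
  by rewrite mulr_ge0 ?expR_ge0// g0// ax (le_trans xt).
have : 0 <= expR (- c * a) * f a by rewrite mulr_ge0// expR_ge0.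
have E (p u i : R) : 0 <= u -> 0 <= i -> p - u = i -> 0 <= p by lra.
move=> H1 H2 H3; have := E _ _ _ H1 H2 H3.
by rewrite pmulr_rge0// expR_gt0.
Qed.

Lemma positivity_bwd a b c f g : prim a f (fun x => c * f x + g x) ->
  (forall x, a <= x <= b -> g x <= 0) -> 0 <= f b ->
  forall t, a <= t <= b -> 0 <= f t.
Proof.
move=> /integrating_factor fg g0 fb t /andP[at_ tb].
have := prim_sub fg at_ tb.
have : 0 <= I_ t b (fun x => - (expR (- c * x) * g x)).
  apply: Rintegral_ge0 => x /=; rewrite in_itv/= => /andP[ax xt].
  by rewrite -mulrN mulr_ge0 ?expR_ge0// oppr_ge0 g0// xt (le_trans at_).
have gi : itv_integrable t b (fun x => expR (- c * x) * g x) by exact: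
  (prim_itv_integrable b at_ fg).
have -> : I_ t b (fun x => - (expR (- c * x) * g x)) =
  - I_ t b (fun x => expR (- c * x) * g x).
  by rewrite -[RHS]mulN1r -itv_integralZ//; apply: eq_itv_integral => x _; ring.
have : 0 <= expR (- c * b) * f b by rewrite mulr_ge0// expR_ge0.
have E (p u i : R) : 0 <= p -> 0 <= - i -> p - u = i -> 0 <= u by lra.
move=> H1 H2 H3; have := E _ _ _ H1 H2 H3.
by rewrite pmulr_rge0// expR_gt0.
Qed.

(** Variation of constants. The point s where the value is prescribed is free, because for a
    positive exponent it will be the right end of the interval. *)
Lemma linear_solution a c s y g : a <= s -> (forall T, itv_integrable a T g) ->
  exists2 u, prim a u (fun x => c * u x + g x) & u s = y.
Proof.
move=> as_ gi.
pose e x := expR (- c * x) * g x.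
have ei T : itv_integrable a T e.
  have [M _ eM] := hcont_bounded T (@hcont_expR a (- c)).
  apply: (itv_integrableM_bounded (M := M)) => //.
  apply: measurable_funS (hcont_measurable (@hcont_expR a (- c))) => //.
  by apply: subset_itv; rewrite bnd_simp.
pose C := expR (- c * s) * y - I_ a s e.
pose G x := C + I_ a x e.
have GP : prim a G e by split => // t at_; rewrite /G itv_integral_point addr0.
exists (fun x => expR (c * x) * G x).
  apply: prim_eq (prim_expM c GP) => // t at_.
  by rewrite /e -mulrA; congr (_ + _); rewrite mulrA -expRD mulNr subrr expR0 mul1r.
by rewrite /G /C subrK mulrA -expRD mulNr subrr expR0 mul1r.
Qed.

(* The role of Young's inequality below is played by this cruder bound, which
   is valid for all q >= 1. *)
Lemma le_add_powR (q l x : R) : 1 <= q -> 0 < l -> 0 <= x ->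
  x <= l + l `^ (1 - q) * x `^ q.
Proof.
move=> q1 l0 x0; have [xl|lx] := leP x l.
  by rewrite (le_trans xl)// lerDl mulr_ge0 ?powR_ge0.
have : l * (x / l) <= l * (x / l) `^ q.
  rewrite ler_pM2l//; apply: le1r_powR => //.
  by rewrite ler_pdivlMr// mul1r ltW.
have -> : l * (x / l) = x by field; rewrite gt_eqF.
have -> : l * (x / l) `^ q = l `^ (1 - q) * x `^ q.
  have -> : l `^ (1 - q) = l / l `^ q.
    by rewrite powRB ?(gt_eqF l0) ?implybT// powRr1// ltW.
  rewrite powRM ?invr_ge0 ?(ltW l0)//.
  by rewrite -(powR_inv1 (ltW l0)) -powRrM mulN1r powRN; ring.
by move/le_trans; apply; rewrite lerDr ltW.
Qed.

(** Optimization over l: the choice l = u^(1/q) turns both terms into multiples of l, and the bound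
    becomes (k + 1) l. If u = 0, let l tend to 0 instead. *)
Lemma powR_le_of_forall (q k u w : R) : 1 <= q -> 0 <= k -> 0 <= u -> 0 <= w ->
  (forall l, 0 < l -> w <= l * k + l `^ (1 - q) * u) ->
  w `^ q <= (k + 1) `^ q * u.
Proof.
move=> q1 k0 u0 w0 H; have q0 : q != 0 by rewrite gt_eqF//; lra.
have [uE|un0] := eqVneq u 0.
  have wz : w = 0.
    apply/eqP; rewrite eq_le w0 andbT; apply/ler_addgt0Pr => e e0.
    have l0 : 0 < e / (k + 1) by rewrite divr_gt0//; lra.
    apply: (le_trans (H _ l0)); rewrite uE mulr0 addr0 add0r mulrAC ler_pdivrMr;
      nra.
  by rewrite wz powR0// uE mulr0.
have {}u0 : 0 < u by rewrite lt_def un0.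
pose l := u `^ q^-1.
have l0 : 0 < l by exact: powR_gt0.
have lq : l `^ q = u by rewrite /l -powRrM mulVf// powRr1// ltW.
have := H _ l0; rewrite -{1}lq -powRD; last by rewrite (gt_eqF l0) implybT.
rewrite subrK powRr1; last exact: ltW.
move=> wl; have {}wl : w <= (k + 1) * l by lra.
rewrite -{1}lq -powRM; [|lra|exact: ltW].
apply: ge0_ler_powR => //; rewrite ?nnegrE//; first lra.
by rewrite mulr_ge0//; [lra|exact: ltW].
Qed.

(* The majorant U solves the first-order equation with source |f|^q; its sign
   sg makes the equation propagate positivity from the end point c of [a, b]
   where the initial value is prescribed. *)
Lemma majorant a b c (gam q M sg : R) v f : a <= b -> 1 <= q -> gam != 0 ->
  0 <= M ->
  (c, sg) = (if gam < 0 then (a, 1) else (b, -1)) ->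
  prim a v (fun x => gam * v x + f x) ->
  (forall T, itv_integrable a T (fun x => `|f x| `^ q)) ->
  `|v c| `^ q <= M ->
  exists U, [/\ prim a U (fun x => gam * U x + sg * `|f x| `^ q), U c = M,
    forall t, a <= t <= b -> 0 <= U t &
    forall l t, 0 < l -> a <= t <= b ->
      `|v t| <= l * (1 + `|gam|^-1) + l `^ (1 - q) * U t].
Proof.
move=> ab q1 gam0 M0 csg vf fqi vc.
have ac : a <= c by move: csg; case: ifP => _ [-> _].
have fsi T : itv_integrable a T (fun x => sg * `|f x| `^ q) by exact:
  itv_integrableZ.
have [U PU Uc] := linear_solution gam M ac fsi.
have pos g Y : prim a Y (fun x => gam * Y x + sg * g x) ->
    (forall x, a <= x <= b -> 0 <= g x) -> 0 <= Y c ->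
    forall t, a <= t <= b -> 0 <= Y t.
  move=> PY g0 Yc; move: csg PY Yc.
  case: ifP => _ [-> ->] PY Yc.
    by apply: (positivity_fwd PY) => // x xab; rewrite mul1r g0.
  by apply: (positivity_bwd PY) => // x xab; rewrite mulN1r oppr_le0 g0.
exists U; split => //.
  apply: (pos _ _ PU); first by move=> x _; exact: powR_ge0.
  by rewrite Uc.
move=> l t l0 tab.
have sgE : gam * sg = - `|gam|.
  move: csg; case: ltP => g0 [_ ->]; first by rewrite ltr0_norm//; ring.
  by rewrite ger0_norm//; ring.
have sg2 : sg * sg = 1 by move: csg; case: ifP => _ [_ ->]; ring.
have gamN0 : `|gam| != 0 by rewrite normr_eq0.
have key (tau : R) : `|tau| = 1 -> tau * v t <= l * (1 + `|gam|^-1) + l `^ (1 -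
  q) * U t.
  move=> tau1.
  pose k := l * (1 + `|gam|^-1).
  (* The two summands of k = l + l / |gam| have separate roles. As a constant solution, l / |gam|
     contributes the source l that [le_add_powR] needs to dominate |f|; the summand l is what the
     same inequality needs to dominate |v c| at the starting point. *)
  pose Y x := k + l `^ (1 - q) * U x + - tau * v x.
  pose g x := (l * (1 + `|gam|) + l `^ (1 - q) * `|f x| `^ q) - sg * tau * f x.
  have PY : prim a Y (fun x => gam * Y x + sg * g x).
    apply: prim_eq (primD (primD (prim_cst a k) (primZ (l `^ (1 - q)) PU)) (primZ
      (- tau) vf)).
      by move=> x _.
    move=> x _; rewrite /Y /g.
    have -> : sg * (l * (1 + `|gam|) + l `^ (1 - q) * `|f x| `^ q - sg * tau * f
      x) =
      - gam * k + sg * l `^ (1 - q) * `|f x| `^ q - tau * f x.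
      have -> : - gam * k = sg * l * (1 + `|gam|).
        have -> : gam = - `|gam| * sg by rewrite -sgE -mulrA sg2 mulr1.
        have -> : `|- `|gam| * sg| = `|gam|.
          rewrite normrM normrN normr_id -[RHS]mulr1; congr (_ * _).
          by move: csg; case: ifP => _ [_ ->]; rewrite ?normrN normr1.
        by rewrite /k; field.
      by rewrite mulrBr !mulrA sg2; ring.
    by ring.
  have : 0 <= Y t.
    apply: (pos _ _ PY) tab.
      move=> x _; rewrite /g.
      have := le_add_powR q1 l0 (normr_ge0 (f x)).
      have : sg * tau * f x <= `|f x|.
        apply: (le_trans (ler_norm _)); rewrite !normrM tau1.
        have -> : `|sg| = 1 by move: csg; case: ifP => _ [_ ->];
          rewrite ?normrN normr1.
        by rewrite !mul1r.
      have : 0 <= l * `|gam| by rewrite mulr_ge0// ltW.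
      lra.
    rewrite /Y Uc /k.
    have : tau * v c <= `|v c| by apply: (le_trans (ler_norm _));
      rewrite normrM tau1 mul1r.
    have := le_add_powR q1 l0 (normr_ge0 (v c)).
    have : l `^ (1 - q) * `|v c| `^ q <= l `^ (1 - q) * M by rewrite ler_wpM2l//
      powR_ge0.
    have : 0 <= l * `|gam|^-1 by rewrite mulr_ge0 ?invr_ge0// ltW.
    lra.
  by rewrite /Y /k; lra.
rewrite ler_norml; apply/andP; split.
  by have := key (-1); rewrite normrN normr1 => /(_ erefl); lra.
by have := key 1; rewrite normr1 => /(_ erefl); lra.
Qed.

(** Integrate the equation of U over [a, b], and between c and t. Thanks to the choice of sg the
    term with gam U has the favourable sign; at the end point opposite to c only U >= 0 is used. *)
Lemma majorant_le a b c (gam q M sg : R) U f : a <= b -> gam != 0 ->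
  (c, sg) = (if gam < 0 then (a, 1) else (b, -1)) ->
  prim a U (fun x => gam * U x + sg * `|f x| `^ q) -> U c = M ->
  (forall t, a <= t <= b -> 0 <= U t) ->
  (forall T, itv_integrable a T (fun x => `|f x| `^ q)) ->
  `|gam| * I_ a b U <= M + I_ a b (fun x => `|f x| `^ q) /\
  (forall t, a <= t <= b -> U t <= M + I_ a b (fun x => `|f x| `^ q)).
Proof.
move=> ab gam0 csg PU Uc U0 fqi.
have cU := prim_hcont PU.
have fq0 s t : 0 <= I_ s t (fun x => `|f x| `^ q).
  by apply: Rintegral_ge0 => x _; exact: powR_ge0.
have fqi' s t : a <= s -> itv_integrable s t (fun x => `|f x| `^ q).
  by move=> as_; exact: itv_integrableW (fqi t).
have Ui s t : a <= s -> itv_integrable s t U by move=> as_;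
  exact: hcont_itv_integrable cU.
have inc s t : a <= s -> s <= t -> U t - U s =
    gam * I_ s t U + sg * I_ s t (fun x => `|f x| `^ q).
  move=> as_ st; rewrite (prim_sub PU as_ st) itv_integralD;
    first by rewrite !itv_integralZ//; [exact: fqi'|exact: Ui].
    by apply: itv_integrableZ; exact: Ui.
  by apply: itv_integrableZ; exact: fqi'.
have IU0 s t : a <= s -> t <= b -> 0 <= I_ s t U.
  move=> as_ tb; apply: Rintegral_ge0 => x /=; rewrite in_itv/= => /andP[sx xt].
  by apply: U0; apply/andP; split; [exact: le_trans sx|exact: le_trans tb].
have Uab : 0 <= U a /\ 0 <= U b by split; apply: U0; rewrite ?lexx ?ab.
split.
  have := inc a b (lexx a) ab; move: csg Uc; case: ltP => g0 [-> ->] <-.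
    by rewrite ltr0_norm// => H; case: Uab => ? ?; lra.
  by rewrite ger0_norm// => H; case: Uab => ? ?; lra.
move=> t /andP[at_ tb].
have S := itv_integral_split at_ tb (fqi b).
have E1 (p u gi i1 i2 tot : R) : tot = i1 + i2 -> 0 <= i2 -> gi <= 0 ->
  p - u = gi + 1 * i1 -> p <= u + tot by lra.
have E2 (p u gi i1 i2 tot : R) : tot = i1 + i2 -> 0 <= i1 -> 0 <= gi ->
  p - u = gi + -1 * i2 -> u <= p + tot by lra.
move: csg Uc inc; case: ltP => g0 [-> ->] <- inc.
  apply: (E1 _ _ _ _ _ _ S (fq0 t b) _ (inc a t (lexx a) at_)).
  by rewrite nmulr_rle0// IU0.
apply: (E2 _ _ _ _ _ _ S (fq0 a t) _ (inc t b at_ tb)).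
by rewrite mulr_ge0// IU0.
Qed.

(* Membership in L^q([a, +oo[), phrased with bounds on [a, T] that are uniform
   in T (see LpP). *)
Definition Lq_on a (q : R) f :=
  [/\ measurable_fun `[a, +oo[ f, forall T, itv_integrable a T (fun x => `|f x|
    `^ q) &
    exists J, forall T, a <= T -> I_ a T (fun x => `|f x| `^ q) <= J].

(** The numerator is the factor (k + 1)^q of [powR_le_of_forall] for k = 1 + 1 / |gam|; the division
    by |gam| comes from the integral bound of [majorant_le]. *)
Definition first_order_const (gam q : R) := (1 + `|gam|^-1 + 1) `^ q / `|gam|.

Lemma measurable_powR_norm D (q : R) f : measurable_fun D f ->
  measurable_fun D (fun x => `|f x| `^ q).
Proof.
move=> mf; apply: (measurableT_comp (measurable_powR q)).
exact: measurableT_comp.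
Qed.

Lemma hcont_powR_itv_integrable a T (q : R) f : 0 <= q -> hcont a f ->
  itv_integrable a T (fun x => `|f x| `^ q).
Proof.
move=> q0 cf; have [M M0 fM] := hcont_bounded T cf.
apply: (bounded_itv_integrable (M := M `^ q)).
  apply: measurable_powR_norm; apply: measurable_funS (hcont_measurable cf) => //.
  by apply: subset_itv; rewrite bnd_simp.
move=> x xaT; rewrite ger0_norm ?powR_ge0//.
by apply: ge0_ler_powR; rewrite ?nnegrE// fM.
Qed.

(** M bounds both end values because the sign of gam decides from which end the comparison starts.
    The constant does not depend on the interval, which is what makes it possible to let b tend to
    infinity. *)
Lemma first_order_bound a b (gam q M : R) v f : a <= b -> 1 <= q -> gam != 0 ->
  prim a v (fun x => gam * v x + f x) ->
  (forall T, itv_integrable a T (fun x => `|f x| `^ q)) ->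
  `|v a| `^ q <= M -> `|v b| `^ q <= M ->
  I_ a b (fun x => `|v x| `^ q) <=
    first_order_const gam q * (M + I_ a b (fun x => `|f x| `^ q)).
Proof.
move=> ab q1 gam0 vf fqi va vb.
have M0 : 0 <= M by apply: le_trans va; exact: powR_ge0.
pose cs : R * R := if gam < 0 then (a, 1) else (b, -1).
have csg : (cs.1, cs.2) = if gam < 0 then (a, 1) else (b, -1) by rewrite
  -surjective_pairing.
have vc : `|v cs.1| `^ q <= M by rewrite /cs; case: ifP.
have [U [PU Uc U0 vU]] := majorant ab q1 gam0 M0 csg vf fqi vc.
have [IU _] := majorant_le ab gam0 csg PU Uc U0 fqi.
have gp : 0 < `|gam| by rewrite normr_gt0.
have Ui : itv_integrable a b U by apply: hcont_itv_integrable (prim_hcont PU).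
have q0 : 0 <= q by lra.
apply: (@le_trans _ _ ((1 + `|gam|^-1 + 1) `^ q * I_ a b U)).
  rewrite -itv_integralZ//; apply: le_itv_integral.
  - by apply: hcont_powR_itv_integrable => //; exact: prim_hcont vf.
  - exact: itv_integrableZ.
  move=> x xab; have k0 : 0 <= 1 + `|gam|^-1 by rewrite addr_ge0// invr_ge0.
  exact: (powR_le_of_forall q1 k0 (U0 x xab) (normr_ge0 _) (fun l l0 => vU l x l0
    xab)).
rewrite /first_order_const -mulrA ler_wpM2l ?powR_ge0//.
by rewrite -(ler_pM2l gp) mulrA divff ?mul1r// gt_eqF.
Qed.

Lemma first_order_Lq a (gam q V : R) v f : 1 <= q -> gam != 0 ->
  prim a v (fun x => gam * v x + f x) -> Lq_on a q f ->
  (forall t, a <= t -> `|v t| <= V) -> Lq_on a q v.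
Proof.
move=> q1 gam0 vf [mf fqi [J fJ]] vV; have cv := prim_hcont vf.
have q0 : 0 <= q by lra.
split; [exact: hcont_measurable| |].
  by move=> T; exact: hcont_powR_itv_integrable.
have V0 : 0 <= V by apply: le_trans (vV a _).
have vVq t : a <= t -> `|v t| `^ q <= V `^ q.
  by move=> at_; apply: ge0_ler_powR => //; rewrite ?nnegrE// vV.
exists (first_order_const gam q * (V `^ q + J)) => T aT.
apply: (le_trans (first_order_bound aT q1 gam0 vf fqi (vVq _ _) (vVq _ _))) => //.
rewrite ler_wpM2l//; last by rewrite lerD2l fJ.
by rewrite /first_order_const divr_ge0 ?powR_ge0.
Qed.

Lemma Lq_on_itv_integrable a (q : R) f T : 1 <= q -> Lq_on a q f ->
  itv_integrable a T f.
Proof.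
move=> q1 [mf fqi _].
have mf' : measurable_fun `[a, T] f.
  by apply: measurable_funS mf => //; apply: subset_itv; rewrite bnd_simp.
have : mu.-integrable `[a, T] (EFin \o (fun x => 1 + `|f x| `^ q)).
  exact: (itv_integrableD (itv_integrable_cst a T 1) (fqi T)).
apply: le_integrable => //; first exact/measurable_EFinP.
move=> x _ /=; rewrite lee_fin.
have := le_add_powR q1 ltr01 (normr_ge0 (f x)).
rewrite powR1 mul1r => /le_trans; apply; exact: ler_norm.
Qed.

(** For gam < 0 the solution vanishing at a is bounded. For gam > 0 the solutions vanishing at T are
    bounded on [a, T] by the same K for all T, and they differ by multiples of the growing
    exponential w. The multiples compatible with the bound K at time T form an interval of radius K
    / w T around [Cb T]; any two of these intervals meet, so the supremum of their left ends belongs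
    to all of them. *)
Lemma bounded_solution a (gam q : R) f : 1 <= q -> gam != 0 -> Lq_on a q f ->
  exists u K, prim a u (fun x => gam * u x + f x) /\
    (forall t, a <= t -> `|u t| <= K).
Proof.
move=> q1 gam0 fq; have fi T := Lq_on_itv_integrable T q1 fq.
case: fq => mf fqi [J fJ].
have q0 : q != 0 by rewrite gt_eqF//; lra.
(* The bound of [majorant] for l = 1 and zero initial value, where U is at most J. *)
pose K := 1 + `|gam|^-1 + J.
have main c b u : a <= b -> c = (if gam < 0 then a else b) ->
    prim a u (fun x => gam * u x + f x) -> u c = 0 ->
    forall t, a <= t <= b -> `|u t| <= K.
  move=> ab cE Pu uc t tab.
  pose sg : R := if gam < 0 then 1 else -1.
  have csg : (c, sg) = if gam < 0 then (a, 1) else (b, -1).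
    by rewrite cE /sg; case: ifP.
  have uq : `|u c| `^ q <= 0 by rewrite uc normr0 powR0.
  have [U [PU Uc U0 vU]] := majorant ab q1 gam0 (lexx 0) csg Pu fqi uq.
  have [_ UJ] := majorant_le ab gam0 csg PU Uc U0 fqi.
  apply: (le_trans (vU 1 t ltr01 tab)); rewrite powR1 !mul1r.
  by rewrite lerD2l; apply: (le_trans (UJ t tab)); rewrite add0r fJ.
case: (ltP gam 0) => [gneg|gpos].
  have [u Pu ua] := linear_solution gam 0 (lexx a) fi.
  exists u, K; split => // t at_.
  by apply: (main a t u) => //; rewrite ?gneg ?at_ ?lexx.
have ng : (gam < 0) = false by rewrite ltNge gpos.
have gp : 0 < gam by rewrite lt_def gam0.
pose e x := expR (- gam * x) * f x.
have [u0 Pu0 u0a] := linear_solution gam 0 (lexx a) fi.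
pose w x := expR (gam * (x - a)).
have w0 x : 0 < w x by exact: expR_gt0.
have Pw (C : R) : prim a (fun x => u0 x + C * w x) (fun x => gam * (u0 x + C * w
  x) + f x).
  have := primD Pu0 (primZ (C * expR (- gam * a)) (prim_expR a gam)).
  have wE x : C * w x = C * expR (- gam * a) * expR (gam * x).
    by rewrite -mulrA -expRD; congr (_ * expR _); ring.
  by apply: prim_eq => t _; rewrite wE//; ring.
pose Cb T := - u0 T / w T.
have CbT T t : a <= t -> t <= T -> `|u0 t + Cb T * w t| <= K.
  move=> at_ tT; have aT := le_trans at_ tT.
  apply: (main T T _ aT _ (Pw (Cb T))); rewrite ?ng ?at_//.
  by rewrite /Cb mulrAC -mulrA divff ?mulr1 ?subrr// gt_eqF.
have CC T T' : a <= T -> T <= T' -> `|Cb T' - Cb T| <= K / w T.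
  move=> aT TT'; rewrite ler_pdivlMr//.
  have -> : `|Cb T' - Cb T| * w T = `|u0 T + Cb T' * w T|.
    rewrite -[X in _ * X](gtr0_norm (w0 T)) -normrM; congr `|_|.
    by rewrite /Cb; field; rewrite !gt_eqF.
  exact: CbT.
pose A := [set Cb T - K / w T | T in [set T | a <= T]].
have K0 : 0 <= K by apply: le_trans (CbT a a (lexx a) (lexx a)).
have ub T' : a <= T' -> ubound A (Cb T' + K / w T').
  move=> aT' _ [T /= aT <-].
  have [TT'|/ltW T'T] := leP T T'.
    have := CC T T' aT TT'; rewrite ler_norml => /andP[].
    have : 0 <= K / w T' by rewrite divr_ge0// ltW.
    lra.
  have := CC T' T aT' T'T; rewrite ler_norml => /andP[].
  have : 0 <= K / w T by rewrite divr_ge0// ltW.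
  lra.
have A0 : A !=set0 by exists (Cb a - K / w a); exists a => /=.
have supA : has_sup A by split => //; exists (Cb a + K / w a); exact: ub.
exists (fun x => u0 x + sup A * w x), K; split => // t at_.
have H1 : Cb t - K / w t <= sup A by apply: ub_le_sup; [case: supA|exists t].
have H2 : sup A <= Cb t + K / w t by apply: ge_sup => //; exact: ub.
have -> : u0 t + sup A * w t = (sup A - Cb t) * w t.
  by rewrite /Cb; field; rewrite gt_eqF.
rewrite normrM (gtr0_norm (w0 t)) -ler_pdivlMr// ler_norml.
by apply/andP; split; lra.
Qed.

End first_order.

(** * Lp spaces on a half-line *)

Section integrability.
Context {R : realType}.
Local Notation mu := (@lebesgue_measure R).
Implicit Types (a b c s t x : R) (f g h k : R -> R).
Local Notation "'I_' a b f" := (\int[mu]_(s in `[a, b]) f s)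
  (at level 10, a, b, f at level 9).

(** The integral of a nonnegative function is a supremum over the simple functions below it, so it
    is monotone for arbitrary functions. This is what allows [Lcal] to be bounded from below without
    studying the measurability of the derivatives of the kernel in s. *)
Lemma ge0_le_integral_nomeas d (T : measurableType d) (m : {measure set T ->
  \bar R})
  (D : set T) (f g : T -> \bar R) :
  (forall y, D y -> 0 <= f y)%E -> (forall y, D y -> f y <= g y)%E ->
  (\int[m]_(y in D) f y <= \int[m]_(y in D) g y)%E.
Proof.
move=> f0 fg; have g0 y : D y -> (0 <= g y)%E.
  by move=> Dy; exact: le_trans (f0 y Dy) (fg y Dy).
rewrite !ge0_integralE //= ge_ereal_sup// => _ [h/= hfD] <-.
apply: le_ereal_sup_tmp; eexists; last exact: lexx.
exists h => //= y.
apply: (le_trans (hfD y)); rewrite /patch; case: ifPn => //.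
by rewrite inE => /fg.
Qed.

Lemma itv_integral_fin a b f : itv_integrable a b f ->
  (\int[mu]_(x in `[a, b]) (f x)%:E = (I_ a b f)%:E)%E.
Proof. by move=> fi; rewrite /Rintegral fineK//; exact: integrable_fin_num. Qed.

(** Monotone convergence along [a, a + n]: the passage from bounds uniform in T to the half-line. *)
Lemma integral_halfline_le a f (J : R) : measurable_fun `[a, +oo[ f ->
  (forall x, a <= x -> 0 <= f x) -> (forall T, itv_integrable a T f) ->
  (forall T, a <= T -> I_ a T f <= J) ->
  (\int[mu]_(x in `[a, +oo[) (f x)%:E <= J%:E)%E.
Proof.
move=> mf f0 fi fJ.
pose g n := (EFin \o f) \_ `[a, a + n%:R]%classic.
have mE : measurable_fun `[a, +oo[ (EFin \o f) by exact/measurable_EFinP.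
have mg n : measurable_fun `[a, +oo[ (g n).
  apply/(measurable_restrict (EFin \o f)) => //;
    apply: measurable_funS mE => //.
have g0 n x : `[a, +oo[%classic x -> (0 <= g n x)%E.
  rewrite /= in_itv/= andbT => ax; rewrite /g patchE; case: ifP => //= _.
  by rewrite lee_fin f0.
have ndg x : `[a, +oo[%classic x -> nondecreasing_seq (g ^~ x).
  rewrite /= in_itv/= andbT => ax m n mn; rewrite /g !patchE.
  case: ifPn => [|_]; last first.
    by case: ifP => // _; rewrite /= lee_fin f0.
  rewrite inE/= in_itv/= => /andP[_ xm]; rewrite ifT// inE/= in_itv/= ax/=.
  by rewrite (le_trans xm)// lerD2l ler_nat.
have -> : (\int[mu]_(x in `[a, +oo[) (f x)%:E =
    \int[mu]_(x in `[a, +oo[) limn (g ^~ x))%E.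
  apply: eq_integral => x; rewrite inE/= in_itv/= andbT => ax.
  apply/esym/cvg_lim => //; apply: cvg_near_cst.
  exists (Num.truncn (x - a)).+1 => // n /= xn; apply/esym.
  rewrite /g patchE ifT// inE/= in_itv/= ax/=.
  rewrite -lerBlDl ltW//; apply: lt_le_trans (truncnS_gt _) _.
  by rewrite ler_nat.
rewrite monotone_convergence//; apply: lime_le.
  apply: ereal_nondecreasing_is_cvgn => m n mn.
  by apply: ge0_le_integral_nomeas => x Dx; [exact: g0|exact: (ndg x Dx _ _ mn)].
apply: nearW => n; rewrite /g -integral_mkcondr.
rewrite (_ : (_ `&` _)%classic = `[a, a + n%:R]%classic); last first.
  by apply/seteqP; split => x /=; rewrite !in_itv/=; [case|case/andP => -> ->].
by rewrite itv_integral_fin// lee_fin fJ// lerDl.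
Qed.

Lemma le_integral_halfline a b T f : measurable_fun `[a, +oo[ f ->
  (forall x, a <= x -> 0 <= f x) ->
  (\int[mu]_(x in `[a, +oo[) (f x)%:E < +oo)%E -> a <= b ->
  itv_integrable b T f /\
  ((I_ b T f)%:E <= \int[mu]_(x in `[a, +oo[) (f x)%:E)%E.
Proof.
move=> mf f0 foo ab.
have mE : measurable_fun `[a, +oo[ (EFin \o f) by exact/measurable_EFinP.
have sub : `[b, T] `<=` `[a, +oo[%classic.
  by move=> x /=; rewrite !in_itv/= => /andP[bx _]; rewrite andbT (le_trans ab).
have fi : itv_integrable b T f.
  apply: (@integrableS _ _ _ mu `[a, +oo[%classic `[b, T]%classic (EFin \o f)) =>
    //.
  apply/integrableP; split => //; apply: le_lt_trans foo.
  apply: ge0_le_integral_nomeas => // x /=; rewrite in_itv/= andbT => ax.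
  by rewrite lee_fin ger0_norm ?f0.
split => //; rewrite -itv_integral_fin//; apply: ge0_subset_integral => // x /=.
by rewrite in_itv/= andbT => ax; rewrite lee_fin f0.
Qed.

(** * Membership in Lp through uniform bounds on compact intervals *)

Lemma Lp_measurable a p f : Lp a p f -> measurable_fun `[a, +oo[ f.
Proof.
move=> /andP[+ _]; rewrite inE/= => mf; exact/(measurable_restrictT _ _).2.
Qed.

Lemma Lnorm_halfline a (q : R) f : q != 0 ->
  ('N[mu]_q%:E [EFin \o f \_ `[a, +oo[] =
    (\int[mu]_(x in `[a, +oo[) (`|f x| `^ q)%:E) `^ q^-1)%E.
Proof.
move=> q0; rewrite unlock; congr (_ `^ _)%E; rewrite [RHS]integral_mkcond.
apply: eq_integral => x _; rewrite /= !patchE; case: ifP => //= _.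
by rewrite normr0 powR0.
Qed.

Lemma LpP a (q : R) f : 0 < q -> Lp a q%:E f <-> Lq_on a q f.
Proof.
move=> q0; have qn0 : q != 0 by rewrite gt_eqF.
split.
  move=> fp; have mf := Lp_measurable fp.
  have mq := measurable_powR_norm q mf.
  move: fp => /andP[_]; rewrite inE /= /finite_norm Lnorm_halfline// => foo.
  have pos x : a <= x -> 0 <= `|f x| `^ q by move=> _; exact: powR_ge0.
  have {}foo : (\int[mu]_(x in `[a, +oo[) (`|f x| `^ q)%:E < +oo)%E.
    move: foo; set X := (\int[mu]_(x in _) _)%E.
    have X0 : (0 <= X)%E by apply: integral_ge0 => x _; rewrite lee_fin powR_ge0.
    move=> /(poweR_lty q); rewrite -poweRrM mulVf// poweRe1//.
  split => //.
    by move=> T; have [] := le_integral_halfline T mq pos foo (lexx a).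
  exists (fine (\int[mu]_(x in `[a, +oo[) (`|f x| `^ q)%:E)) => T aT.
  have X0 : (0 <= \int[mu]_(x in `[a, +oo[) (`|f x| `^ q)%:E)%E.
    by apply: integral_ge0 => x _; rewrite lee_fin powR_ge0.
  have Xf : (\int[mu]_(x in `[a, +oo[) (`|f x| `^ q)%:E)%E \is a fin_num by
    rewrite ge0_fin_numE.
  rewrite -lee_fin (fineK Xf).
  by have [] := le_integral_halfline T mq pos foo (lexx a).
move=> [mf fi [J fJ]]; apply/andP; split.
  by rewrite inE/=; exact/(measurable_restrictT _ _).1.
rewrite inE /= /finite_norm Lnorm_halfline//; apply: poweR_lty.
apply: (@le_lt_trans _ _ J%:E); last exact: ltry.
by apply: integral_halfline_le => //; first exact: measurable_powR_norm.
Qed.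

Lemma Lp_eq a p f g : (forall x, a <= x -> f x = g x) -> Lp a p f -> Lp a p g.
Proof.
move=> fg; rewrite /Lp /=; suff -> : f \_ `[a, +oo[ = g \_ `[a, +oo[ by [].
apply/funext => x; rewrite !patchE; case: ifPn => //.
by rewrite inE/= in_itv/= andbT => /fg.
Qed.

Lemma Lp_bounded a f (M : R) : measurable_fun `[a, +oo[ f ->
  (forall x, a <= x -> `|f x| <= M) -> Lp a +oo%E f.
Proof.
move=> mf fM; apply/andP; split.
  by rewrite inE/=; exact/(measurable_restrictT _ _).1.
rewrite inE /= /finite_norm unlock; case: ifP => // _.
apply: (@le_lt_trans _ _ `|M|%:E); last exact: ltry.
apply/ess_supP/nearW => x /=; rewrite lee_fin patchE.
case: ifPn => [|_]; last by rewrite normr0.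
by rewrite inE/= in_itv/= andbT => /fM /le_trans; apply; exact: ler_norm.
Qed.

Lemma powR_add_le (q x y : R) : 1 <= q -> 0 <= x -> 0 <= y ->
  (x + y) `^ q <= 2 `^ q * (x `^ q + y `^ q).
Proof.
move=> q1 x0 y0; have q0 : 0 <= q by lra.
wlog xy : x y x0 y0 / x <= y.
  move=> H; have [|/ltW] := leP x y; first exact: H.
  by move=> yx; rewrite [X in X `^ _]addrC [X in _ * X]addrC; exact: H.
apply: (@le_trans _ _ ((2 * y) `^ q)).
  by apply: ge0_ler_powR => //; rewrite ?nnegrE; lra.
by rewrite powRM// ler_wpM2l ?powR_ge0// lerDr powR_ge0.
Qed.

Lemma Lq_on_le a (q : R) f g : 1 <= q -> measurable_fun `[a, +oo[ f ->
  (forall x, a <= x -> `|f x| `^ q <= g x) -> (forall T, itv_integrable a T g) ->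
  (exists J, forall T, a <= T -> I_ a T g <= J) -> Lq_on a q f.
Proof.
move=> q1 mf fg gi [J gJ].
have fi T : itv_integrable a T (fun x => `|f x| `^ q).
  have : mu.-integrable `[a, T] (EFin \o g) by exact: gi.
  apply: le_integrable => //.
    apply/measurable_EFinP; apply: measurable_powR_norm.
    by apply: measurable_funS mf => //; apply: subset_itv; rewrite bnd_simp.
  move=> x /=; rewrite in_itv/= => /andP[ax _].
  by rewrite lee_fin ger0_norm ?powR_ge0//; apply: (le_trans (fg x ax));
    exact: ler_norm.
split => //; exists J => T aT; apply: le_trans (gJ T aT);
  apply: le_itv_integral => //.
by move=> x /andP[ax _]; exact: fg.
Qed.

Lemma Lq_on_mono a (q : R) f g : 1 <= q -> measurable_fun `[a, +oo[ f ->
  (forall x, a <= x -> `|f x| <= `|g x|) -> Lq_on a q g -> Lq_on a q f.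
Proof.
move=> q1 mf fg [mg gi gJ]; apply: (Lq_on_le q1 mf _ gi gJ) => x ax.
by apply: ge0_ler_powR; rewrite ?nnegrE ?fg//; lra.
Qed.

Lemma Lq_onD a (q : R) f g : 1 <= q -> Lq_on a q f -> Lq_on a q g ->
  Lq_on a q (fun x => f x + g x).
Proof.
move=> q1 [mf fi [J fJ]] [mg gi [K gK]].
have q0 : 0 <= q by lra.
apply: (Lq_on_le (g := fun x => 2 `^ q * (`|f x| `^ q + `|g x| `^ q))) => //.
- exact: measurable_funD.
- move=> x ax; apply: (@le_trans _ _ ((`|f x| + `|g x|) `^ q)).
    by apply: ge0_ler_powR; rewrite ?nnegrE ?addr_ge0 ?ler_normD.
  exact: powR_add_le.
- by move=> T; exact: (itv_integrableZ (2 `^ q) (itv_integrableD (fi T) (gi T))).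
- exists (2 `^ q * (J + K)) => T aT.
  rewrite itv_integralZ; last exact: (itv_integrableD (fi T) (gi T)).
  rewrite (itv_integralD (fi T) (gi T)) ler_wpM2l ?powR_ge0//.
  exact: lerD (fJ T aT) (gK T aT).
Qed.

Lemma Lq_onZ a (q c : R) f : 1 <= q -> Lq_on a q f -> Lq_on a q (fun x => c * f x).
Proof.
move=> q1 [mf fi [J fJ]].
apply: (Lq_on_le (g := fun x => `|c| `^ q * `|f x| `^ q)) => //.
- exact: measurable_funM.
- by move=> x ax; rewrite normrM powRM.
- by move=> T; exact: (itv_integrableZ _ (fi T)).
- by exists (`|c| `^ q * J) => T aT; rewrite itv_integralZ// ler_wpM2l
  ?powR_ge0// fJ.
Qed.

Lemma Lq_on_eq a (q : R) f g : (forall x, a <= x -> f x = g x) ->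
  Lq_on a q f -> Lq_on a q g.
Proof.
move=> fg [mf fi [J fJ]]; split.
- apply: eq_measurable_fun mf => x; rewrite inE/= in_itv/= andbT; exact: fg.
- by move=> T; apply: eq_itv_integrable (fi T) => x /andP[/fg ->].
- exists J => T aT; apply: le_trans (fJ T aT); rewrite le_eqVlt; apply/orP; left.
  by apply/eqP/eq_itv_integral => x /andP[/fg ->].
Qed.

Lemma Lq_on0 a (q : R) : 1 <= q -> Lq_on a q (fun=> 0).
Proof.
move=> q1; have q0 : q != 0 by rewrite gt_eqF//; lra.
have E : (fun x : R => `|0 : R| `^ q) = (fun=> 0) by apply/funext => x;
  rewrite normr0 powR0.
split; [exact: measurable_cst|by move=> T; rewrite E; exact: itv_integrable_cst|].
by exists 0 => T aT; rewrite E itv_integral_cst// mul0r.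
Qed.

Lemma Lq_on_sum a (q : R) (I : Type) (r : seq I) (P : pred I) (F : I -> R -> R) :
  1 <= q -> (forall i, P i -> Lq_on a q (F i)) ->
  Lq_on a q (fun x => \sum_(i <- r | P i) F i x).
Proof.
move=> q1 HF; elim: r => [|i r ih].
  by apply: Lq_on_eq (Lq_on0 a q1) => x _; rewrite big_nil.
case Pi : (P i).
  by apply: Lq_on_eq (Lq_onD q1 (HF i Pi) ih) => x _; rewrite big_cons Pi.
by apply: Lq_on_eq ih => x _; rewrite big_cons Pi.
Qed.

(** Brings back to a the estimates that can only be made on [b, +oo[, where the perturbation is
    small. *)
Lemma Lq_on_extend a b (q : R) f : 1 <= q -> a <= b -> hcont a f ->
  Lq_on b q f -> Lq_on a q f.
Proof.
move=> q1 ab cf [_ fi [J fJ]]; have q0 : 0 <= q by lra.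
have fqi T : itv_integrable a T (fun x => `|f x| `^ q) by exact:
  hcont_powR_itv_integrable.
have F0 s t : 0 <= I_ s t (fun x => `|f x| `^ q).
  by apply: Rintegral_ge0 => x _; exact: powR_ge0.
split => //; first exact: hcont_measurable.
exists (I_ a b (fun x => `|f x| `^ q) + J) => T aT.
have [bT|/ltW Tb] := leP b T; first by rewrite (itv_integral_split ab bT)//
  lerD2l fJ.
rewrite (itv_integral_split aT Tb)//.
have E (p u v w : R) : 0 <= u -> v <= w -> 0 <= w -> p <= p + u + w by lra.
apply: E (F0 T b) (fJ b (lexx b)) _.
exact: le_trans (F0 b b) (fJ b (lexx b)).
Qed.

Lemma W2p_prim a (q : R) u u1 u2 : 0 < q -> prim a u u1 -> prim a u1 u2 ->
  hcont a u2 ->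
  Lq_on a q u -> Lq_on a q u1 -> Lq_on a q u2 -> W2p a q%:E u.
Proof.
move=> q0 Pu Pu1 cu2 Lu Lu1 Lu2.
have cu1 := prim_hcont Pu1.
have d1 t : a <= t -> u1 t = derivn_on a 1 u t by move=> ?;
  rewrite /= (prim_deriv_on Pu).
have Pd : prim a (derivn_on a 1 u) u2 by exact: prim_eq Pu1.
split; [exact: prim_loc_AC Pu cu1|exact: prim_loc_AC Pd cu2|].
have L0 : Lp a q%:E u := (LpP a u q0).2 Lu.
have L1 : Lp a q%:E (derivn_on a 1 u) := (LpP a _ q0).2 (Lq_on_eq d1 Lu1).
have d2 t : a <= t -> u2 t = derivn_on a 2 u t.
  by move=> at_; rewrite -(prim_deriv_on Pd cu2 at_).
have L2 : Lp a q%:E (derivn_on a 2 u) := (LpP a _ q0).2 (Lq_on_eq d2 Lu2).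
move=> l l2; case: l l2 => [_|l]; first exact: L0.
case: l => [_|l]; first exact: L1.
case: l => [_|l]; first exact: L2.
by move=> l3; exfalso; move: l3; rewrite !ltnS ltn0.
Qed.

Lemma derivn_on_prim a u u1 u2 l : prim a u u1 -> prim a u1 u2 -> hcont a u2 ->
  (l <= 2)%N -> forall t, a <= t -> derivn_on a l u t = nth (fun=> 0) [:: u; u1;
    u2] l t.
Proof.
move=> Pu Pu1 cu2; have cu1 := prim_hcont Pu1.
have d1 t : a <= t -> u1 t = derivn_on a 1 u t by move=> ?;
  rewrite /= (prim_deriv_on Pu).
have Pd : prim a (derivn_on a 1 u) u2 by exact: prim_eq Pu1.
case: l => [|[|[|//]]] _ t at_ //; first by rewrite -d1.
by rewrite -[RHS](prim_deriv_on Pd).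
Qed.

End integrability.

(** * Third-order equations *)

Section third_order.
Context {R : realType}.
Local Notation mu := (@lebesgue_measure R).
Implicit Types (a b c s t x : R) (f g h k : R -> R).
Local Notation "'I_' a b f" := (\int[mu]_(s in `[a, b]) f s)
  (at level 10, a, b, f at level 9).
Variables (g1 g2 g3 : R).
Hypotheses (g10 : g1 != 0) (g20 : g2 != 0) (g30 : g3 != 0).

(* With v = (D - g2)(D - g3)u, the third-order equation reads v' = g1 v + f. *)
Definition third_order_solution a u u1 u2 f :=
  [/\ prim a u u1, prim a u1 u2 &
    prim a (fun t => u2 t - (g2 + g3) * u1 t + g2 * g3 * u t)
      (fun t => g1 * (u2 t - (g2 + g3) * u1 t + g2 * g3 * u t) + f t)].

Lemma third_order_hcont a u u1 u2 f :
  third_order_solution a u u1 u2 f -> hcont a u2.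
Proof.
move=> [Pu Pu1 Pv].
have H := hcontD (prim_hcont Pv)
  (hcontD (hcontZ (c := g2 + g3) (prim_hcont Pu1)) (hcontZ (c := - (g2 * g3))
    (prim_hcont Pu))).
by apply: hcont_eq H => t _; ring.
Qed.

Lemma third_order_second a u u1 u2 f : third_order_solution a u u1 u2 f ->
  prim a (fun t => u1 t - g3 * u t)
    (fun t => g2 * (u1 t - g3 * u t) + (u2 t - (g2 + g3) * u1 t + g2 * g3 * u t)).
Proof.
move=> [Pu Pu1 _]; apply: prim_eq (primD Pu1 (primZ (- g3) Pu)) => t _; ring.
Qed.

Lemma third_order_first a u u1 u2 f : third_order_solution a u u1 u2 f ->
  prim a u (fun t => g3 * u t + (u1 t - g3 * u t)).
Proof. by move=> [Pu _ _]; apply: prim_eq Pu => t _ //; ring. Qed.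

Lemma third_order_exists a q f : 1 <= q -> Lq_on a q f ->
  exists u u1 u2 K, third_order_solution a u u1 u2 f /\
    (forall t, a <= t -> [/\ `|u t| <= K, `|u1 t| <= K & `|u2 t| <= K]).
Proof.
move=> q1 fq.
have [v [V [Pv vV]]] := bounded_solution q1 g10 fq.
have vq := first_order_Lq q1 g10 Pv fq vV.
have [w [W [Pw wW]]] := bounded_solution q1 g20 vq.
have wq := first_order_Lq q1 g20 Pw vq wW.
have [u [U [Pu uU]]] := bounded_solution q1 g30 wq.
(* [u1] and [u2] are u' and u'' as read off from u' = g3 u + w and w' = g2 w + v. *)
pose u1 t := g3 * u t + w t.
pose u2 t := g3 * u1 t + g2 * w t + v t.
pose K1 := `|g3| * U + W; pose K2 := `|g3| * K1 + `|g2| * W + V.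
have u1K t : a <= t -> `|u1 t| <= K1.
  move=> at_; apply: (le_trans (ler_normD _ _)); rewrite normrM.
  by rewrite lerD ?wW// ler_wpM2l ?uU.
have u2K t : a <= t -> `|u2 t| <= K2.
  move=> at_; apply: (le_trans (ler_normD _ _)); apply: lerD; last exact: vV.
  apply: (le_trans (ler_normD _ _)); rewrite !normrM.
  by rewrite lerD ?ler_wpM2l ?u1K ?wW.
exists u, u1, u2, (Num.max U (Num.max K1 K2)); split.
  split; first by [].
    apply: prim_eq (primD (primZ g3 Pu) Pw) => t _; rewrite /u2 /u1; ring.
  apply: prim_eq Pv => t _; rewrite /u2 /u1; ring.
by move=> t at_; split; rewrite !le_max ?uU ?u1K ?u2K ?orbT.
Qed.

Lemma third_order_Lq a q V u u1 u2 f : 1 <= q ->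
  third_order_solution a u u1 u2 f -> Lq_on a q f ->
  (forall t, a <= t -> [/\ `|u t| <= V, `|u1 t| <= V & `|u2 t| <= V]) ->
  [/\ Lq_on a q u, Lq_on a q u1 & Lq_on a q u2].
Proof.
move=> q1 S fq B; have [_ _ Pv] := S.
have vV t : a <= t -> `|u2 t - (g2 + g3) * u1 t + g2 * g3 * u t| <=
    V + `|g2 + g3| * V + `|g2 * g3| * V.
  move=> /B[b0 b1 b2]; apply: (le_trans (ler_normD _ _)); apply: lerD.
    by apply: (le_trans (ler_normB _ _)); rewrite normrM lerD// ler_wpM2l.
  by rewrite normrM ler_wpM2l.
have vq := first_order_Lq q1 g10 Pv fq vV.
have wW t : a <= t -> `|u1 t - g3 * u t| <= V + `|g3| * V.
  by move=> /B[b0 b1 b2]; apply: (le_trans (ler_normB _ _));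
    rewrite normrM lerD// ler_wpM2l.
have wq := first_order_Lq q1 g20 (third_order_second S) vq wW.
have uq : Lq_on a q u.
  by apply: (first_order_Lq q1 g30 (third_order_first S) wq (V := V)) => t /B[].
have u1q : Lq_on a q u1.
  by apply: Lq_on_eq (Lq_onD q1 wq (Lq_onZ g3 q1 uq)) => t _; ring.
split; [exact: uq|exact: u1q|].
apply: Lq_on_eq (Lq_onD q1 vq (Lq_onD q1 (Lq_onZ (g2 + g3) q1 u1q)
  (Lq_onZ (- (g2 * g3)) q1 uq))) => t _; ring.
Qed.

Lemma powR_add3_le (q x y z : R) : 1 <= q -> 0 <= x -> 0 <= y -> 0 <= z ->
  (x + y + z) `^ q <= 4 `^ q * (x `^ q + y `^ q + z `^ q).
Proof.
move=> q1 x0 y0 z0; have xy0 : 0 <= x + y by lra.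
apply: (le_trans (powR_add_le q1 xy0 z0)).
have -> : (4 : R) `^ q = 2 `^ q * 2 `^ q by rewrite -powRM//; congr (_ `^ _); ring.
rewrite -mulrA ler_wpM2l ?powR_ge0//.
rewrite [leRHS]mulrDr; apply: lerD; first exact: powR_add_le.
rewrite ler_peMl ?powR_ge0//.
have : (1 : R) `^ q <= 2 `^ q by apply: ge0_ler_powR; rewrite ?nnegrE//; lra.
by rewrite powR1.
Qed.

(* For eta small, the contribution of h to the bounds on [a, T] is at most half
   of their left-hand sides, which are finite, uniformly in T. *)
Lemma third_order_absorb q : 1 <= q -> exists2 eta, 0 < eta &
  forall a V u u1 u2 f h,
  third_order_solution a u u1 u2 (fun t => f t + h t) -> Lq_on a q f ->
  measurable_fun `[a, +oo[ h ->
  (forall t, a <= t -> `|h t| <= eta * (`|u t| + `|u1 t| + `|u2 t|)) ->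
  (forall t, a <= t -> [/\ `|u t| <= V, `|u1 t| <= V & `|u2 t| <= V]) ->
  [/\ Lq_on a q u, Lq_on a q u1 & Lq_on a q u2].
Proof.
move=> q1; have q0 : 0 < q by lra.
have qn0 : q != 0 by rewrite gt_eqF.
pose k1 := first_order_const g1 q; pose k2 := first_order_const g2 q;
  pose k3 := first_order_const g3 q.
have kpos gam : gam != 0 -> 0 < first_order_const gam q.
  move=> gam0; apply: divr_gt0; last by rewrite normr_gt0.
  apply: powR_gt0; have : 0 <= `|gam|^-1 by rewrite invr_ge0.
  by lra.
have k10 : 0 < k1 by exact: kpos.
have k20 : 0 < k2 by exact: kpos.
have k30 : 0 < k3 by exact: kpos.
(* Chaining the bounds for v, w and u, the sum of their three integrals is at most [A1] times that
   of the full source plus [A0] times the bound on the end values. *)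
pose A1 := k1 + k2 * k1 + k3 * k2 * k1.
pose A0 := A1 + (k2 + k3 * k2 + k3).
have k21 : 0 < k2 * k1 by rewrite mulr_gt0.
have k321 : 0 < k3 * k2 * k1 by exact: (mulr_gt0 (mulr_gt0 k30 k20) k10).
have A10 : 0 < A1 by rewrite /A1; lra.
have p2 : 0 < 2 `^ q :> R by rewrite powR_gt0.
have p4 : 0 < 4 `^ q :> R by rewrite powR_gt0.
(* [L] compares |u| + |u1| + |u2| with |u| + |w| + |v|. Then eps is chosen so that A1 2^q 4^q eps =
   1/2, the powers of 2 and 4 being lost when a sum of two or three terms is raised to the power q,
   and eta so that (eta L)^q = eps. *)
pose L := 1 + (`|g3| + 1) + ((`|g3| ^+ 2 + `|g2 + g3|) + 1 + 1).
have g32 : 0 <= `|g3| ^+ 2 by rewrite exprn_ge0.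
have L0 : 0 < L by rewrite /L; have := normr_ge0 g3; have := normr_ge0 (g2 + g3);
  lra.
pose eps := (2 * A1 * 2 `^ q * 4 `^ q)^-1.
have eps0 : 0 < eps.
  by rewrite invr_gt0; apply: mulr_gt0 => //; apply: mulr_gt0 => //;
    exact: mulr_gt0.
pose eta := eps `^ q^-1 / L.
have eta0 : 0 < eta by rewrite divr_gt0// powR_gt0.
exists eta; first exact: eta0.
move=> a V u u1 u2 f h S fq mh hS B.
pose w t := u1 t - g3 * u t.
pose v t := u2 t - (g2 + g3) * u1 t + g2 * g3 * u t.
pose F t := f t + h t.
have [Pu Pu1 Pv] := S.
have cu := prim_hcont Pu; have cu1 := prim_hcont Pu1.
have cu2 := third_order_hcont S.
have Pw := third_order_second S; have Pu' := third_order_first S.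
have cv : hcont a v := prim_hcont Pv.
have cw : hcont a w := prim_hcont Pw.
have mF : measurable_fun `[a, +oo[ F by apply: measurable_funD => //; case: fq.
have u1E t : u1 t = g3 * u t + w t by rewrite /w; ring.
have u2E t : u2 t = g3 ^+ 2 * u t + (g2 + g3) * w t + v t by rewrite /w /v; ring.
have nsq : `|g3 ^+ 2| = `|g3| ^+ 2 by rewrite normrX.
have hL t : a <= t -> `|h t| <= eta * L * (`|u t| + `|w t| + `|v t|).
  move=> /hS; move/le_trans; apply; rewrite -mulrA ler_wpM2l ?(ltW eta0)//.
  have : `|u1 t| <= `|g3| * `|u t| + `|w t|.
    by rewrite u1E; apply: (le_trans (ler_normD _ _)); rewrite normrM.
  have : `|u2 t| <= `|g3| ^+ 2 * `|u t| + `|g2 + g3| * `|w t| + `|v t|.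
    rewrite u2E; apply: (le_trans (ler_normD _ _)); rewrite lerD2r.
    by apply: (le_trans (ler_normD _ _)); rewrite normrM nsq normrM.
  rewrite /L; move: (normr_ge0 (u t)) (normr_ge0 (w t)) (normr_ge0 (v t))
    (normr_ge0 g3) (normr_ge0 (g2 + g3)) g32.
  move: `|u t| `|w t| `|v t| `|g3| `|g2 + g3| (`|g3| ^+ 2) `|u1 t| `|u2 t|.
  move=> p r s m n e p1 p2' p0 r0 s0 m0 n0 e0 H2 H1.
  have : 0 <= m * r + m * s + e * r + e * s + n * p + n * s by rewrite
    !addr_ge0// mulr_ge0.
  by nra.
have hq t : a <= t -> `|h t| `^ q <= eps * 4 `^ q * (`|u t| `^ q + `|w t| `^ q +
  `|v t| `^ q).
  move=> at_; have H := hL t at_.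
  apply: (@le_trans _ _ ((eta * L * (`|u t| + `|w t| + `|v t|)) `^ q)).
    by apply: ge0_ler_powR; rewrite ?nnegrE// ?(le_trans _ H)//; lra.
  rewrite powRM; [|by rewrite mulr_ge0// ltW|by rewrite !addr_ge0].
  have -> : (eta * L) `^ q = eps.
    by rewrite /eta divfK ?gt_eqF// -powRrM mulVf// powRr1// ltW.
  rewrite -mulrA ler_wpM2l ?(ltW eps0)//; exact: powR_add3_le.
have [_ fqi [J fJ]] := fq.
have ui T := hcont_powR_itv_integrable T (ltW q0) cu.
have wi T := hcont_powR_itv_integrable T (ltW q0) cw.
have vi T := hcont_powR_itv_integrable T (ltW q0) cv.
have gi T : itv_integrable a T (fun t => eps * 4 `^ q * (`|u t| `^ q + `|w t| `^
  q + `|v t| `^ q)).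
  exact: (itv_integrableZ _ (itv_integrableD (itv_integrableD (ui T) (wi T)) (vi
    T))).
have Gi T : itv_integrable a T (fun t => 2 `^ q * (`|f t| `^ q
    + eps * 4 `^ q * (`|u t| `^ q + `|w t| `^ q + `|v t| `^ q))).
  exact: (itv_integrableZ _ (itv_integrableD (fqi T) (gi T))).
have FG t : a <= t -> `|F t| `^ q <= 2 `^ q * (`|f t| `^ q
    + eps * 4 `^ q * (`|u t| `^ q + `|w t| `^ q + `|v t| `^ q)).
  move=> at_; apply: (@le_trans _ _ ((`|f t| + `|h t|) `^ q)).
    by apply: ge0_ler_powR; rewrite ?nnegrE ?addr_ge0 ?ler_normD//; lra.
  apply: (le_trans (powR_add_le q1 _ _)) => //.
  by rewrite ler_wpM2l ?(ltW p2)// lerD2l hq.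
pose W := V + `|g2 + g3| * V + `|g2 * g3| * V + (V + `|g3| * V) + V.
have V0 : 0 <= V by have [H _ _] := B a (lexx a); exact: le_trans H.
have z1 : 0 <= `|g2 + g3| * V by rewrite mulr_ge0.
have z2 : 0 <= `|g2 * g3| * V by rewrite mulr_ge0.
have z3 : 0 <= `|g3| * V by rewrite mulr_ge0.
have vW t : a <= t -> `|v t| <= W.
  move=> /B[b0 b1 b2]; apply: (@le_trans _ _ (V + `|g2 + g3| * V + `|g2 * g3| *
    V)); last by rewrite /W; lra.
  apply: (le_trans (ler_normD _ _)); apply: lerD.
    by apply: (le_trans (ler_normB _ _)); rewrite normrM lerD// ler_wpM2l.
  by rewrite normrM ler_wpM2l.
have wW t : a <= t -> `|w t| <= W.
  move=> /B[b0 b1 b2]; apply: (@le_trans _ _ (V + `|g3| * V));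
    last by rewrite /W; lra.
  by apply: (le_trans (ler_normB _ _)); rewrite normrM lerD// ler_wpM2l.
have uW t : a <= t -> `|u t| <= W.
  by move=> /B[b0 _ _]; apply: (le_trans b0); rewrite /W; lra.
have Wq (y : R -> R) t : (forall t, a <= t -> `|y t| <= W) -> a <= t ->
  `|y t| `^ q <= W `^ q.
  move=> yW at_; apply: ge0_ler_powR; rewrite ?nnegrE//; first lra.
    by apply: le_trans (yW t at_).
  exact: yW.
have Fi T : itv_integrable a T (fun t => `|F t| `^ q).
  have : mu.-integrable `[a, T] (EFin \o (fun t => 2 `^ q * (`|f t| `^ q
    + eps * 4 `^ q * (`|u t| `^ q + `|w t| `^ q + `|v t| `^ q)))) by exact: Gi.
  apply: le_integrable => //.
    apply/measurable_EFinP; apply: measurable_powR_norm.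
    by apply: measurable_funS mF => //; apply: subset_itv; rewrite bnd_simp.
  move=> x /=; rewrite in_itv/= => /andP[ax _].
  by rewrite lee_fin ger0_norm ?powR_ge0//; apply: (le_trans (FG x ax));
    exact: ler_norm.
pose X (y : R -> R) T := I_ a T (fun t => `|y t| `^ q).
have bound T : a <= T -> X u T + X w T + X v T <= 2 * (A0 * W `^ q + A1 * 2 `^ q
  * J).
  move=> aT.
  have Bv := first_order_bound aT q1 g10 Pv Fi (Wq v a vW (lexx a)) (Wq v T vW aT).
  have Bw := first_order_bound aT q1 g20 Pw vi (Wq w a wW (lexx a)) (Wq w T wW aT).
  have Bu := first_order_bound aT q1 g30 Pu' wi (Wq u a uW (lexx a)) (Wq u T uW aT).
  have BF : X F T <= 2 `^ q * (X f T + eps * 4 `^ q * (X u T + X w T + X v T)).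
    apply: (@le_trans _ _ (I_ a T (fun t => 2 `^ q * (`|f t| `^ q
      + eps * 4 `^ q * (`|u t| `^ q + `|w t| `^ q + `|v t| `^ q))))).
      by apply: le_itv_integral => // x /andP[ax _]; exact: FG.
    rewrite itv_integralZ; last exact: (itv_integrableD (fqi T) (gi T)).
    rewrite (itv_integralD (fqi T) (gi T)).
    rewrite itv_integralZ; last exact: (itv_integrableD (itv_integrableD (ui T)
      (wi T)) (vi T)).
    rewrite (itv_integralD (itv_integrableD (ui T) (wi T)) (vi T)).
    rewrite (itv_integralD (ui T) (wi T)); exact: lexx.
  have BJ : X f T <= J by exact: fJ.
  have X0 y : 0 <= X y T by apply: Rintegral_ge0 => x _; exact: powR_ge0.
  rewrite -/(X v T) -/(X F T) -/k1 in Bv.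
  rewrite -/(X w T) -/(X v T) -/k2 in Bw.
  rewrite -/(X u T) -/(X w T) -/k3 in Bu.
  have W0 : 0 <= W `^ q by exact: powR_ge0.
  have epsE : A1 * 2 `^ q * (eps * 4 `^ q) = 2^-1.
    by rewrite /eps; field; rewrite !gt_eqF.
  move: Bv Bw Bu BF BJ W0 epsE (X0 u) (X0 w) (X0 v).
  move: (X u T) (X w T) (X v T) (X F T) (X f T) (W `^ q) => xu xw xv xF xf m.
  move=> Bv Bw Bu BF BJ m0 epsE xu0 xw0 xv0.
  have H1 : xw <= k2 * m + k2 * k1 * (m + xF).
    by apply: (le_trans Bw); rewrite -mulrA -mulrDr ler_wpM2l ?(ltW k20)// lerD2l.
  have H2 : xu <= k3 * m + k3 * (k2 * m + k2 * k1 * (m + xF)).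
    by apply: (le_trans Bu); rewrite -mulrDr ler_wpM2l ?(ltW k30)// lerD2l.
  have H3 : A1 * xF <= A1 * (2 `^ q * (J + eps * 4 `^ q * (xu + xw + xv))).
    rewrite ler_wpM2l ?(ltW A10)//; apply: (le_trans BF).
    by rewrite ler_wpM2l ?(ltW p2)// lerD2r.
  have E : A1 * (2 `^ q * (J + eps * 4 `^ q * (xu + xw + xv))) =
    A1 * 2 `^ q * J + 2^-1 * (xu + xw + xv) by rewrite -epsE; ring.
  have T1 : xu + xw + xv <= A0 * m + A1 * xF by rewrite /A0 /A1; lra.
  rewrite E in H3; lra.
(* Now that u, w and v are controlled uniformly in T, the full source is in L^q and the unperturbed
   estimate applies. *)
have Fq : Lq_on a q F.
  split => //.
  exists (2 `^ q * (J + eps * 4 `^ q * (2 * (A0 * W `^ q + A1 * 2 `^ q * J)))) =>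
    T aT.
  apply: (@le_trans _ _ (I_ a T (fun t => 2 `^ q * (`|f t| `^ q
      + eps * 4 `^ q * (`|u t| `^ q + `|w t| `^ q + `|v t| `^ q))))).
    by apply: le_itv_integral => // x /andP[ax _]; exact: FG.
  rewrite itv_integralZ; last exact: (itv_integrableD (fqi T) (gi T)).
  rewrite (itv_integralD (fqi T) (gi T)).
  rewrite itv_integralZ; last exact: (itv_integrableD (itv_integrableD (ui T) (wi
    T)) (vi T)).
  rewrite (itv_integralD (itv_integrableD (ui T) (wi T)) (vi T)).
  rewrite (itv_integralD (ui T) (wi T)).
  rewrite ler_wpM2l ?(ltW p2)// lerD ?fJ// ler_wpM2l ?mulr_ge0 ?(ltW eps0) ?(ltW
    p4)//.
  exact: bound.
exact: (third_order_Lq q1 S Fq B).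
Qed.

End third_order.

(** * The Green kernel *)

Section green_kernel.
Context {R : realType}.
Local Notation mu := (@lebesgue_measure R).
Implicit Types (a b s t x : R) (f g h k : R -> R) (c : sign_class).
Local Notation "'I_' a b f" := (\int[mu]_(s in `[a, b]) f s)
  (at level 10, a, b, f at level 9).

Lemma is_derive_expR_shift (r s t : R) :
  is_derive t 1 (fun x => expR (- r * (x - s))) (- r * expR (- r * (t - s))).
Proof.
have E : is_derive t 1 (fun x => - r * (x - s)) (- r : R).
  have D1 : is_derive t 1 ((@id R) - cst s) (1 - 0 : R) by exact: is_deriveB.
  have : is_derive t 1 (- r \*: ((@id R) - cst s)) (- r *: (1 - 0)) by exact:
    is_deriveZ.
  by rewrite /GRing.scale/= subr0 mulr1.
have := @is_derive1_comp R expR (fun x => - r * (x - s)) t _ _ _ E.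
by move=> /(_ (expR (- r * (t - s)))) H; rewrite mulrC; apply: H;
  exact: is_derive_expR.
Qed.

Definition expsum (r1 r2 r3 a1 a2 a3 : R) s t :=
  a1 * expR (- r1 * (t - s)) + a2 * expR (- r2 * (t - s)) + a3 * expR (- r3 * (t
    - s)).

Lemma is_derive_expsum (r1 r2 r3 a1 a2 a3 : R) s t :
  is_derive t 1 (expsum r1 r2 r3 a1 a2 a3 s)
    (expsum r1 r2 r3 (a1 * - r1) (a2 * - r2) (a3 * - r3) s t).
Proof.
have D (r a : R) : is_derive t 1 (fun x => a * expR (- r * (x - s)))
    (a * - r * expR (- r * (t - s))).
  have : is_derive t 1 (a \*: (fun x => expR (- r * (x - s))))
      (a *: (- r * expR (- r * (t - s)))).
    by apply: is_deriveZ; exact: is_derive_expR_shift.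
  by rewrite /GRing.scale/= mulrA.
exact: (is_deriveD (is_deriveD (D r1 a1) (D r2 a2)) (D r3 a3)).
Qed.

(** The open set U is one side of the diagonal: only there is the kernel a single exponential sum,
    and differentiation is local. *)
Lemma derive1n_expsum (U : set R) f (r1 r2 r3 a1 a2 a3 : R) s : open U ->
  (forall t, U t -> f t = expsum r1 r2 r3 a1 a2 a3 s t) ->
  forall l t, U t -> derive1n l f t =
    expsum r1 r2 r3 (a1 * (- r1) ^+ l) (a2 * (- r2) ^+ l) (a3 * (- r3) ^+ l) s t.
Proof.
move=> oU fE; elim=> [|l ih] t Ut; first by rewrite derive1n0 fE// !expr0 !mulr1.
rewrite derive1nS derive1E.
have H := is_derive_expsum r1 r2 r3 (a1 * (- r1) ^+ l) (a2 * (- r2) ^+ l) (a3 *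
  (- r3) ^+ l) s t.
have : is_derive t 1 (derive1n l f) (expsum r1 r2 r3 (a1 * (- r1) ^+ l * - r1)
    (a2 * (- r2) ^+ l * - r2) (a3 * (- r3) ^+ l * - r3) s t).
  apply: near_eq_is_derive H; have := open_nbhs_nbhs (conj oU Ut).
  by apply: filterS => y /ih ->.
by move=> [_ ->]; rewrite -!mulrA -!exprSr.
Qed.

(* Applying (D + r2)(D + r3) isolates the first exponential. *)
Lemma expsum_lower (r1 r2 r3 a1 a2 a3 : R) s t :
  `|a1 * ((r1 - r2) * (r1 - r3))| * expR (- r1 * (t - s)) <=
  (1 + `|r2 + r3| + `|r2 * r3|) *
  \sum_(l < 3) `|expsum r1 r2 r3 (a1 * (- r1) ^+ l) (a2 * (- r2) ^+ l) (a3 * (-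
    r3) ^+ l) s t|.
Proof.
rewrite -[X in _ * X <= _](ger0_norm (expR_ge0 _)) -normrM.
rewrite !big_ord_recl big_ord0 addr0 /= /bump /= !add1n.
set p0 := expsum _ _ _ _ _ _ _ _; set p1 := expsum _ _ _ _ _ _ _ _.
set p2 := expsum _ _ _ _ _ _ _ _.
have -> : a1 * ((r1 - r2) * (r1 - r3)) * expR (- r1 * (t - s)) =
   p2 + (r2 + r3) * p1 + r2 * r3 * p0.
  by rewrite /p0 /p1 /p2 /expsum; ring.
apply: (le_trans (ler_normD _ _)); rewrite normrM.
apply: (@le_trans _ _ (`|p2| + `|r2 + r3| * `|p1| + `|r2 * r3| * `|p0|)).
  by rewrite lerD2r (le_trans (ler_normD _ _))// normrM.
have := normr_ge0 p0; have := normr_ge0 p1; have := normr_ge0 p2.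
have := normr_ge0 (r2 + r3); have := normr_ge0 (r2 * r3).
move: `|p0| `|p1| `|p2| `|r2 + r3| `|r2 * r3| => x0 x1 x2 m n n0 m0 x20 x10 x00.
have : 0 <= m * x0 + m * x2 + n * x1 + n * x2 by rewrite !addr_ge0// mulr_ge0.
by nra.
Qed.

(** In every sign class the exponential of r1 is present, with the nonzero coefficient a1, on one
    side of the diagonal: t < s for [MMM], s < t otherwise. On that side [expsum_lower] isolates it,
    and the strip 1 <= |t - s| <= 2 stays off the diagonal and keeps it above exp(- 2 |r1|). *)
Lemma dgreen_lower c (r1 r2 r3 : R) : r1 > r2 -> r2 > r3 ->
  exists2 kap, 0 < kap & forall t s,
    (if c is MMM then 1 <= s - t <= 2 else 1 <= t - s <= 2) ->
    kap <= \sum_(l < 3) `|dgreen c r1 r2 r3 l t s|.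
Proof.
move=> r12 r23; pose K := ((r3 - r2) * (r3 - r1) * (r2 - r1))^-1.
have K0 : K != 0 by rewrite /K invr_eq0 !mulf_neq0// subr_eq0; lra.
pose a1 := K * (r2 - r3).
pose A := `|a1 * ((r1 - r2) * (r1 - r3))|.
have A0 : 0 < A.
  by rewrite normr_gt0 /a1 !mulf_neq0// subr_eq0; lra.
pose B := 1 + `|r2 + r3| + `|r2 * r3|.
have B0 : 0 < B by rewrite /B; have := normr_ge0 (r2 + r3);
  have := normr_ge0 (r2 * r3); lra.
exists (A * expR (- (2 * `|r1|)) / B).
  by rewrite divr_gt0// mulr_gt0// expR_gt0.
move=> t s ts.
have [a2 [a3 [U [oU Ut UE]]]] : exists a2 a3, exists U : set R,
   [/\ open U, U t & forall y, U y -> green c r1 r2 r3 y s = expsum r1 r2 r3 a1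
     a2 a3 s y].
  move: ts; case: c => /andP[ts1 ts2].
  - exists (K * (r3 - r1)), (K * (r1 - r2)), [set y | y < s]; split => /=.
    + exact: open_lt.
    + lra.
    + by move=> y ys; rewrite /green /green_num ltNge (ltW ys)/= /expsum /a1 /K;
      ring.
  - exists 0, 0, [set y | s < y]; split => /=.
    + exact: open_gt.
    + lra.
    + by move=> y ys; rewrite /green /green_num ys /expsum /a1 /K; ring.
  - exists (K * (r3 - r1)), 0, [set y | s < y]; split => /=.
    + exact: open_gt.
    + lra.
    + by move=> y ys; rewrite /green /green_num ys /expsum /a1 /K; ring.
  - exists (K * (r3 - r1)), (K * (r1 - r2)), [set y | s < y]; split => /=.
    + exact: open_gt.
    + lra.
    + by move=> y ys; rewrite /green /green_num ys /expsum /a1 /K; ring.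
rewrite (eq_bigr (fun l : 'I_3 => `|expsum r1 r2 r3 (a1 * (- r1) ^+ l) (a2 * (-
  r2) ^+ l)
  (a3 * (- r3) ^+ l) s t|)); last first.
  by move=> l _; rewrite /dgreen (derive1n_expsum oU UE).
rewrite ler_pdivrMr// [leRHS]mulrC; apply: le_trans (expsum_lower r1 r2 r3 a1 a2
  a3 s t).
rewrite ler_wpM2l ?(ltW A0)// ler_expR.
have ts2 : `|t - s| <= 2 by rewrite ler_norml; move: ts; case: (c) => /andP[? ?];
  apply/andP; split; lra.
have : `|r1 * (t - s)| <= `|r1| * 2 by rewrite normrM ler_wpM2l.
by rewrite ler_norml => /andP[]; lra.
Qed.

(** Cauchy criterion: T0 is a point where the integral from a is within e of its supremum. *)
Lemma Lq_on_tail a (q : R) f (e : R) : 1 <= q -> Lq_on a q f -> 0 < e ->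
  exists2 T0, a <= T0 & forall s t, T0 <= s -> s <= t ->
    I_ s t (fun x => `|f x| `^ q) <= e.
Proof.
move=> q1 [_ fi [J fJ]] e0.
pose X T := I_ a T (fun x => `|f x| `^ q).
pose A := [set X T | T in [set T | a <= T]].
have supA : has_sup A.
  split; first by exists (X a); exists a => /=.
  by exists J => _ [T /= aT <-]; exact: fJ.
have [_ [T0 /= aT0 <-] XT0] := sup_adherent e0 supA.
exists T0 => // s t T0s st; have as_ := le_trans aT0 T0s.
have at_ := le_trans as_ st.
have F0 p r : 0 <= I_ p r (fun x => `|f x| `^ q).
  by apply: Rintegral_ge0 => x _; exact: powR_ge0.
have Xt : X t <= sup A by apply: ub_le_sup; [case: supA|exists t].
have E1 := itv_integral_split as_ st (fi t).
have E2 := itv_integral_split aT0 T0s (fi s).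
have E (p r u v w z : R) : p = r + u -> r = v + w -> 0 <= w -> p <= z ->
  z - e < v -> u <= e by lra.
exact: E E1 E2 (F0 _ _) Xt XT0.
Qed.

(* If Lcal W tends to 0 then the averages of W over unit windows tend to 0,
   which leaves no room for a constant part of a coefficient. *)
Lemma constant_part_eq0 c (r1 r2 r3 t0 q lc : R) (W Om g : R -> R) :
  r1 > r2 -> r2 > r3 -> 1 <= q ->
  Lcal c r1 r2 r3 t0 W t @[t --> +oo] --> 0%E ->
  (forall s, t0 <= s -> `|Om s| <= `|W s|) ->
  (forall s, t0 <= s -> Om s = g s + lc) ->
  Lq_on t0 q g -> lc = 0.
Proof.
move=> r12 r23 q1 LW OmW OmE gq.
apply/eqP/negPn/negP => lc0; have {}lc0 : 0 < `|lc| by rewrite normr_gt0.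
have [kap kap0 kapP] := dgreen_lower c r12 r23.
(* On a late window of length 1 the integral of |Om| will be at most e and that of |g| at most 2 e,
   while their sum is at least |lc| = 4 e. The tail bound d is such that e^(1-q) d = e, which makes
   [le_add_powR] with l = e give 2 e. *)
pose e := `|lc| / 4; have e0 : 0 < e by rewrite /e; lra.
pose d := e / e `^ (1 - q).
have d0 : 0 < d by rewrite divr_gt0// powR_gt0.
have [T0 t0T0 tail] := Lq_on_tail q1 gq d0.
have [T1 HT1] : exists T1, forall t, T1 < t -> (Lcal c r1 r2 r3 t0 W t < (kap *
  e)%:E)%E.
  have : (0 < (kap * e)%:E)%E by rewrite lte_fin mulr_gt0.
  move=> /(@open_ereal_lt' R) /LW [T1 [_ H]]; exists T1 => t; exact: H.
pose t := Num.max T0 T1 + 3.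
have tT0 : T0 + 3 <= t by rewrite /t lerD2r le_max lexx.
have tT1 : T1 < t by rewrite (@le_lt_trans _ _ (Num.max T0 T1))// ?le_max ?lexx
  ?orbT// /t; lra.
(* The window [a, a + 1] lies in the strip where the kernel is bounded from below; the shift by 3 in
   t keeps it to the right of T0. *)
pose a := if c is MMM then t + 1 else t - 2.
have aT0 : T0 <= a by rewrite /a; case: (c); lra.
have win x : a <= x <= a + 1 -> if c is MMM then 1 <= x - t <= 2 else 1 <= t - x
  <= 2.
  by rewrite /a; case: (c) => /andP[ax xa]; apply/andP; split; lra.
have t0a : t0 <= a by lra.
have aa1 : a <= a + 1 by lra.
have gi T : itv_integrable t0 T g := Lq_on_itv_integrable T q1 gq.
have gi1 : itv_integrable a (a + 1) g by exact: itv_integrableW (gi (a + 1)).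
have Omi : itv_integrable a (a + 1) Om.
  apply: eq_itv_integrable (itv_integrableD gi1 (itv_integrable_cst a (a + 1)
    lc)) => x /andP[ax _].
  by rewrite OmE// (le_trans t0a).
have Omi' : itv_integrable a (a + 1) (fun x => kap * `|Om x|) := itv_integrableZ
  kap (itv_integrable_norm Omi).
have H1 : I_ a (a + 1) (fun x => `|Om x|) <= e.
  have : ((I_ a (a + 1) (fun x => (kap * `|Om x|)%R))%:E <= Lcal c r1 r2 r3 t0 W
    t)%E.
    rewrite -itv_integral_fin// /Lcal.
    have -> : (\int[mu]_(x in `[a, (a + 1)%R]) (kap * `|Om x|)%:E =
       \int[mu]_(x in `[t0, +oo[) ((fun x => (kap * `|Om x|)%:E) \_ `[a, (a +
         1)%R]) x)%E.
      rewrite -integral_mkcondr; congr (integral _ _ _).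
      apply/seteqP; split => x /=; rewrite !in_itv/= ?andbT; last by case.
      by move=> /andP[ax xa]; rewrite ax xa (le_trans t0a).
    apply: ge0_le_integral_nomeas => x /=; rewrite in_itv/= andbT => t0x.
      by rewrite patchE; case: ifP => // _; rewrite lee_fin mulr_ge0// ltW.
    rewrite patchE; case: ifPn => [|_]; last first.
      by rewrite lee_fin mulr_ge0//; apply: sumr_ge0.
    rewrite inE/= in_itv/= => /andP[ax xa]; rewrite lee_fin ler_pM ?(ltW kap0)//.
      by apply: kapP; apply: win; rewrite ax.
    exact: OmW.
  move=> /le_lt_trans /(_ (HT1 t tT1)); rewrite lte_fin itv_integralZ;
    last exact: itv_integrable_norm.
  by rewrite ltr_pM2l// => /ltW.
have H2 : I_ a (a + 1) (fun x => `|g x|) <= 2 * e.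
  have gq1 : itv_integrable a (a + 1) (fun x => `|g x| `^ q).
    by case: gq => _ H _; exact: itv_integrableW (H (a + 1)).
  apply: (@le_trans _ _ (I_ a (a + 1) (fun x => e + e `^ (1 - q) * `|g x| `^ q))).
    apply: le_itv_integral; [exact: itv_integrable_norm|exact:
      (itv_integrableD (itv_integrable_cst _ _ _) (itv_integrableZ _ gq1))|].
    by move=> x _; exact: le_add_powR.
  rewrite (itv_integralD (itv_integrable_cst _ _ _) (itv_integrableZ _ gq1))
    itv_integral_cst// itv_integralZ//.
  have := tail a (a + 1) aT0 aa1.
  rewrite -(ler_pM2l (powR_gt0 (1 - q) e0)).
  have -> : e `^ (1 - q) * d = e by rewrite /d mulrC divfK// gt_eqF// powR_gt0.
  by set Y := _ * Rintegral _ _ _; lra.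
have : `|lc| <= I_ a (a + 1) (fun x => `|Om x| + `|g x|).
  have -> : `|lc| = I_ a (a + 1) (fun=> `|lc|) by rewrite itv_integral_cst//; ring.
  apply: le_itv_integral; [exact: itv_integrable_cst|exact:
    (itv_integrableD (itv_integrable_norm Omi) (itv_integrable_norm gi1))|].
  move=> x /andP[ax _]; have -> : lc = Om x - g x by rewrite OmE ?(le_trans
    t0a)//; ring.
  exact: ler_normB.
rewrite (itv_integralD (itv_integrable_norm Omi) (itv_integrable_norm gi1)) => H3.
have E (p r : R) : `|lc| <= p + r -> p <= e -> r <= 2 * e -> False by rewrite /e;
  lra.
exact: E H3 H1 H2.
Qed.

End green_kernel.

(** * Perturbation and decomposition of solutions *)

Section decomposition.
Context {R : realType}.
Local Notation mu := (@lebesgue_measure R).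
Implicit Types (a b s t x : R) (f g h : R -> R) (c : sign_class).
Local Notation "'I_' a b f" := (\int[mu]_(s in `[a, b]) f s)
  (at level 10, a, b, f at level 9).

(** The differential equation holds only almost everywhere; this allows z''' to be replaced under
    the integral by its value from the equation. *)
Lemma prim_ae a f h h' : prim a f h -> measurable_fun `[a, +oo[ h' ->
  {ae mu, forall t, a <= t -> h t = h' t} -> prim a f h'.
Proof.
move=> [hi fh] mh' hh'.
have AE : Filter (almost_everywhere mu) by exact: (ae_filter_ringOfSetsType mu).
have mT T : measurable_fun `[a, T] (EFin \o h').
  apply/measurable_EFinP; apply: measurable_funS mh' => //.
  by apply: subset_itv; rewrite bnd_simp.
have mhT T : measurable_fun `[a, T] (EFin \o h) := measurable_int mu (hi T).
have ae T : {ae mu, forall t, `[a, T]%classic t -> (EFin \o h) t = (EFin \o h') t}.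
  apply: filterS hh' => t ht; rewrite /= in_itv/= => /andP[at_ _].
  by rewrite ht.
have h'i T : itv_integrable a T h'.
  apply/integrableP; split; first exact: mT.
  have /integrableP[_] := hi T; apply: le_lt_trans.
  rewrite le_eqVlt; apply/orP; left; apply/eqP; apply: ae_eq_integral => //.
  - by apply: measurableT_comp => //; exact: mT.
  - by apply: measurableT_comp => //; exact: mhT.
  - by apply: filterS (ae T) => t /[swap] at_ /(_ at_) ->.
split=> // t at_; rewrite fh//; congr (_ + _); rewrite /Rintegral; congr fine.
by apply: ae_eq_integral; [by []|exact: mhT|exact: mT|exact: ae].
Qed.

Lemma hcont_cvg0_bounded a f : hcont a f -> f t @[t --> +oo] --> 0 ->
  exists M, forall t, a <= t -> `|f t| <= M.
Proof.
move=> cf /cvgr0_norm_le /(_ 1 ltr01)[T [_ HT]].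
have [M M0 fM] := hcont_bounded (T + 1) cf.
exists (Num.max M 1) => t at_; rewrite le_max.
have [tT|Tt] := leP t (T + 1); first by rewrite fM ?at_.
by rewrite HT ?orbT//=; lra.
Qed.

(** Vieta's formulas by successive divided differences, each of which divides by a difference of two
    distinct roots. *)
Lemma char_poly3_coefs (b0 b1 b2 r1 r2 r3 : R) : r1 != r2 -> r2 != r3 -> r1 != r3 ->
  root (char_poly3 b0 b1 b2) r1 -> root (char_poly3 b0 b1 b2) r2 ->
  root (char_poly3 b0 b1 b2) r3 ->
  [/\ b2 = - (r1 + r2 + r3), b1 = r1 * r2 + r1 * r3 + r2 * r3 & b0 = - (r1 * r2 *
    r3)].
Proof.
move=> n12 n23 n13.
have E x : root (char_poly3 b0 b1 b2) x = (x ^+ 3 + b2 * x ^+ 2 + b1 * x + b0 == 0).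
  by rewrite rootE /char_poly3 !hornerE.
rewrite !E => /eqP e1 /eqP e2 /eqP e3.
have cancel x y p : x != y -> (x - y) * p = 0 -> p = 0.
  by move=> xy /eqP; rewrite mulf_eq0 subr_eq0 (negPf xy)/= => /eqP.
have q12 : r1 ^+ 2 + r1 * r2 + r2 ^+ 2 + b2 * (r1 + r2) + b1 = 0.
  apply: (cancel _ _ _ n12); transitivity ((r1 ^+ 3 + b2 * r1 ^+ 2 + b1 * r1 + b0) -
    (r2 ^+ 3 + b2 * r2 ^+ 2 + b1 * r2 + b0)); first by ring.
  by rewrite e1 e2 subrr.
have q23 : r2 ^+ 2 + r2 * r3 + r3 ^+ 2 + b2 * (r2 + r3) + b1 = 0.
  apply: (cancel _ _ _ n23); transitivity ((r2 ^+ 3 + b2 * r2 ^+ 2 + b1 * r2 + b0) -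
    (r3 ^+ 3 + b2 * r3 ^+ 2 + b1 * r3 + b0)); first by ring.
  by rewrite e2 e3 subrr.
have q13 : r1 + r2 + r3 + b2 = 0.
  apply: (cancel _ _ _ n13); transitivity ((r1 ^+ 2 + r1 * r2 + r2 ^+ 2 + b2 *
    (r1 + r2) + b1) -
    (r2 ^+ 2 + r2 * r3 + r3 ^+ 2 + b2 * (r2 + r3) + b1)); first by ring.
  by rewrite q12 q23 subrr.
have b2E : b2 = - (r1 + r2 + r3) by lra.
have b1E : b1 = r1 * r2 + r1 * r3 + r2 * r3.
  have -> : b1 = - (r1 ^+ 2 + r1 * r2 + r2 ^+ 2 + b2 * (r1 + r2)) by lra.
  by rewrite b2E; ring.
split => //.
have -> : b0 = - (r1 ^+ 3 + b2 * r1 ^+ 2 + b1 * r1) by lra.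
by rewrite b2E b1E; ring.
Qed.

(** Since H is both in L^q and bounded, H^n lies in L^(q/n) by (H^n)^(q/n) = H^q, and in L^1 when q
    <= n by H^n <= B^(n-q) H^q. *)
Lemma Lq_on_power a (q C B : R) (n : nat) f H : 0 < q -> (0 < n)%N -> 0 <= C ->
  Lq_on a q H -> (forall x, a <= x -> 0 <= H x <= B) ->
  measurable_fun `[a, +oo[ f -> (forall x, a <= x -> `|f x| <= C * H x ^+ n) ->
  (n%:R <= q -> Lq_on a (q / n%:R) f) /\ (q <= n%:R -> Lq_on a 1 f).
Proof.
move=> q0 n0 C0 Hq HB mf fH; have [_ Hi [J HJ]] := Hq.
have n0' : 0 < n%:R :> R by rewrite ltr0n.
have Hn x : a <= x -> `|H x| = H x by move=> /HB /andP[H0 _]; rewrite ger0_norm.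
have K0 (K : R) : 0 <= K -> exists J', forall T, a <= T ->
  I_ a T (fun x => K * `|H x| `^ q) <= J'.
  by move=> KK; exists (K * J) => T aT; rewrite itv_integralZ// ler_wpM2l// HJ.
split=> [nq|qn].
  have qn1 : 1 <= q / n%:R by rewrite ler_pdivlMr// mul1r.
  apply: (Lq_on_le (g := fun x => C `^ (q / n%:R) * `|H x| `^ q)) => //.
  - move=> x ax; have /andP[H0 _] := HB x ax.
    apply: (@le_trans _ _ ((C * H x ^+ n) `^ (q / n%:R))).
      by apply: ge0_ler_powR; rewrite ?nnegrE ?mulr_ge0 ?exprn_ge0 ?fH//; lra.
    rewrite powRM ?exprn_ge0// -powR_mulrn// -powRrM mulrCA divff ?gt_eqF// mulr1.
    by rewrite Hn.
  - by move=> T; exact: itv_integrableZ.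
  - by apply: K0; exact: powR_ge0.
have B0 : 0 <= B by have /andP[H0 HB'] := HB a (lexx a); exact: le_trans HB'.
apply: (Lq_on_le (g := fun x => (C * B `^ (n%:R - q)) * `|H x| `^ q)) => //.
- move=> x ax; have /andP[H0 HB'] := HB x ax.
  rewrite powRr1//; apply: (le_trans (fH x ax)); rewrite Hn// -mulrA ler_wpM2l//.
  rewrite -powR_mulrn//; have {1}-> : n%:R = (n%:R - q) + q by ring.
  rewrite powRD; last by rewrite subrK gt_eqF.
  by rewrite ler_wpM2r ?powR_ge0//; apply: ge0_ler_powR; rewrite ?nnegrE//; lra.
- by move=> T; exact: itv_integrableZ.
- by apply: K0; rewrite mulr_ge0 ?powR_ge0.
Qed.

Lemma W2p_prim_oo a u u1 u2 (M : R) : prim a u u1 -> prim a u1 u2 -> hcont a u2 ->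
  (forall t, a <= t -> [/\ `|u t| <= M, `|u1 t| <= M & `|u2 t| <= M]) ->
    W2p a +oo%E u.
Proof.
move=> Pu Pu1 cu2 B; have cu1 := prim_hcont Pu1; have cu := prim_hcont Pu.
have d1 t : a <= t -> u1 t = derivn_on a 1 u t by move=> ?;
  rewrite /= (prim_deriv_on Pu).
have Pd : prim a (derivn_on a 1 u) u2 by exact: prim_eq Pu1.
have d2 t : a <= t -> u2 t = derivn_on a 2 u t.
  by move=> at_; rewrite -(prim_deriv_on Pd cu2 at_).
have L0 : Lp a +oo%E u.
  by apply: (Lp_bounded (M := M)); [exact: hcont_measurable|by move=> x /B[]].
have L1 : Lp a +oo%E (derivn_on a 1 u).
  apply: (Lp_eq d1); apply: (Lp_bounded (M := M)); first exact: hcont_measurable.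
  by move=> x /B[].
have L2 : Lp a +oo%E (derivn_on a 2 u).
  apply: (Lp_eq d2); apply: (Lp_bounded (M := M)); first exact: hcont_measurable.
  by move=> x /B[].
split; [exact: prim_loc_AC Pu cu1|exact: prim_loc_AC Pd cu2|].
move=> l l2; case: l l2 => [_|l]; first exact: L0.
case: l => [_|l]; first exact: L1.
case: l => [_|l]; first exact: L2.
by move=> l3; exfalso; move: l3; rewrite !ltnS ltn0.
Qed.

(** * Superposition, small perturbations and splitting of the source *)

Variables (g1 g2 g3 : R).
Hypotheses (g10 : g1 != 0) (g20 : g2 != 0) (g30 : g3 != 0).
Local Notation sol := (third_order_solution g1 g2 g3).

Lemma third_order_lin a (al : R) u u1 u2 f v v1 v2 g : sol a u u1 u2 f ->
  sol a v v1 v2 g ->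
  sol a (fun t => u t + al * v t) (fun t => u1 t + al * v1 t)
    (fun t => u2 t + al * v2 t) (fun t => f t + al * g t).
Proof.
move=> [A1 A2 A3] [B1 B2 B3]; split.
- exact: (primD A1 (primZ al B1)).
- exact: (primD A2 (primZ al B2)).
- by apply: prim_eq (primD A3 (primZ al B3)) => t _; ring.
Qed.

Lemma third_order0 a : sol a (fun=> 0) (fun=> 0) (fun=> 0) (fun=> 0).
Proof.
split; [exact: prim_cst|exact: prim_cst|].
by apply: prim_eq (prim_cst a 0) => t _; ring.
Qed.

Lemma third_order_eq a u u1 u2 f u' u1' u2' f' :
  (forall t, a <= t -> u t = u' t) -> (forall t, a <= t -> u1 t = u1' t) ->
  (forall t, a <= t -> u2 t = u2' t) -> (forall t, a <= t -> f t = f' t) ->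
  sol a u u1 u2 f -> sol a u' u1' u2' f'.
Proof.
move=> E0 E1 E2 Ef [A1 A2 A3]; split.
- exact: prim_eq A1.
- exact: prim_eq A2.
- by apply: prim_eq A3 => t at_; rewrite E0// E1// E2// Ef.
Qed.

Lemma third_order_sum a (r : seq nat) (U U1 U2 F : nat -> R -> R) :
  (forall i, i \in r -> sol a (U i) (U1 i) (U2 i) (F i)) ->
  sol a (fun t => \sum_(i <- r) U i t) (fun t => \sum_(i <- r) U1 i t)
    (fun t => \sum_(i <- r) U2 i t) (fun t => \sum_(i <- r) F i t).
Proof.
elim: r => [|i r ih] H.
  by apply: third_order_eq (third_order0 a) => t _; rewrite big_nil.
have H1 := H i (mem_head _ _).
have H2 : sol a _ _ _ _ := ih (fun j jr => H j (mem_behead (s := i :: r) jr)).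
by apply: third_order_eq (third_order_lin 1 H2 H1) => t _;
  rewrite big_cons mul1r addrC.
Qed.

(** The threshold eta of [third_order_absorb] is independent of the starting point. One can
    therefore pass to a b beyond which h is below that threshold, make the estimate on [b, +oo[, and
    treat [a, b] by continuity. *)
Lemma third_order_small_perturbation a (q V : R) u u1 u2 f F h : 1 <= q ->
  sol a u u1 u2 f -> (forall t, a <= t -> f t = F t + h t) ->
  Lq_on a q F -> measurable_fun `[a, +oo[ h ->
  (forall e, 0 < e -> exists2 b, a <= b & forall t, b <= t ->
    `|h t| <= e * (`|u t| + `|u1 t| + `|u2 t|)) ->
  (forall t, a <= t -> [/\ `|u t| <= V, `|u1 t| <= V & `|u2 t| <= V]) ->
  [/\ Lq_on a q u, Lq_on a q u1 & Lq_on a q u2].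
Proof.
move=> q1 S fE Fq mh hsmall B.
have [eta eta0 Heta] := third_order_absorb g10 g20 g30 q1.
have [b ab hb] := hsmall _ eta0.
have Sb : sol b u u1 u2 (fun t => F t + h t).
  have [A1 A2 A3] := third_order_eq (fun _ _ => erefl) (fun _ _ => erefl) (fun _
    _ => erefl) fE S.
  by split; apply: prim_shift ab _.
have sub : `[b, +oo[ `<=` `[a, +oo[%classic.
  by move=> x /=; rewrite !in_itv/= !andbT; exact: le_trans.
have Fqb : Lq_on b q F.
  have [mF Fi [J FJ]] := Fq; split.
  - exact: measurable_funS mF.
  - by move=> T; exact: itv_integrableW (Fi T).
  - exists J => T bT; apply: le_trans (FJ T (le_trans ab bT)).
    rewrite (itv_integral_split ab bT (Fi T)) lerDr; apply: Rintegral_ge0 => x _;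
      exact: powR_ge0.
have mhb : measurable_fun `[b, +oo[ h by exact: measurable_funS mh.
have Bb t : b <= t -> [/\ `|u t| <= V, `|u1 t| <= V & `|u2 t| <= V].
  by move=> bt; apply: B; exact: le_trans bt.
have [H0 H1 H2] := Heta b V u u1 u2 F h Sb Fqb mhb hb Bb.
have [P0 P1 _] := S; have c2 := third_order_hcont S.
by split; apply: (Lq_on_extend q1 ab) => //; [exact: prim_hcont P0|exact:
  prim_hcont P1].
Qed.

(** By linearity Psi = u - sum of the Theta_k has as source the F_k with k > m, all in L^1. It is
    bounded as a difference of bounded functions, so the estimate with exponent 1 applies to it. *)
Lemma third_order_decomposition a (q V : R) (m : nat) u u1 u2 (F : nat -> R -> R) :
  sol a u u1 u2 (fun t => \sum_(1 <= k < 5) F k t) -> (1 <= m <= 4)%N ->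
  (forall k : nat, (1 <= k <= m)%N -> 1 <= q / k%:R /\ Lq_on a (q / k%:R) (F k)) ->
  (forall k : nat, (m < k <= 4)%N -> Lq_on a 1 (F k)) ->
  (forall t, a <= t -> [/\ `|u t| <= V, `|u1 t| <= V & `|u2 t| <= V]) ->
  exists (Theta : nat -> R -> R) (Psi : R -> R),
    [/\ forall k : nat, (1 <= k <= m)%N -> W2p a (q%:E / k%:R%:E)%E (Theta k),
        W2p a 1%E Psi &
        forall l, (l <= 2)%N -> forall t, a <= t ->
          derivn_on a l u t =
            \sum_(1 <= k < m.+1) derivn_on a l (Theta k) t + derivn_on a l Psi t].
Proof.
move=> S /andP[m1 m4] Fsmall Fbig B.
(* The tuple holds a solution, its two derivatives and a bound; zero is the default outside 1..m, as
   [choice] needs a witness for every k. *)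
have ex (k : nat) : exists T : (R -> R) * (R -> R) * (R ->
  R) * R, (1 <= k <= m)%N ->
    sol a T.1.1.1 T.1.1.2 T.1.2 (F k) /\
    (forall t, a <= t -> [/\ `|T.1.1.1 t| <= T.2, `|T.1.1.2 t| <= T.2 & `|T.1.2
      t| <= T.2]).
  have [km|nkm] := boolP (1 <= k <= m)%N; last by exists (fun=> 0, fun=> 0, fun=>
    0, 0).
  have [qk1 Fk] := Fsmall k km.
  have [v [v1 [v2 [K [Sv Bv]]]]] := third_order_exists g10 g20 g30 qk1 Fk.
  by exists (v, v1, v2, K).
have [T HT] := choice ex.
pose Th (k : nat) := (T k).1.1.1; pose Th1 (k : nat) := (T k).1.1.2;
  pose Th2 (k : nat) := (T k).1.2.
pose K (k : nat) := (T k).2.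
pose r := index_iota 1 m.+1.
have rP (k : nat) : k \in r -> (1 <= k <= m)%N by rewrite mem_index_iota ltnS.
have Sr := third_order_sum (fun k kr => (HT k (rP k kr)).1).
pose Psi t := u t + - 1 * \sum_(k <- r) Th k t.
pose Psi1 t := u1 t + - 1 * \sum_(k <- r) Th1 k t.
pose Psi2 t := u2 t + - 1 * \sum_(k <- r) Th2 k t.
pose G t := \sum_(m.+1 <= k < 5) F k t.
have SPsi : sol a Psi Psi1 Psi2 G.
  apply: third_order_eq (third_order_lin (-1) S Sr) => t _ //.
  have -> : \sum_(1 <= k < 5) F k t = \sum_(k <- r) F k t + G t.
    by rewrite /G /r -big_cat_nat.
  by rewrite mulN1r addrC addKr.
have GL : Lq_on a 1 G.
  rewrite /G; pose F' k := if (m < k <= 4)%N then F k else fun=> 0.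
  have : Lq_on a 1 (fun x => \sum_(m.+1 <= k < 5) F' k x).
    apply: Lq_on_sum => // k _; rewrite /F'; case: ifP => // [|_];
      first exact: Fbig.
    exact: Lq_on0.
  by apply: Lq_on_eq => x _; apply: eq_big_nat => k; rewrite /F' ltnS => ->.
have BS (Y : nat -> R -> R) (y : R -> R) : (forall t, a <= t -> `|y t| <= V) ->
    (forall k, k \in r -> forall t, a <= t -> `|Y k t| <= K k) ->
    forall t, a <= t -> `|y t + -1 * \sum_(k <- r) Y k t| <= V + \sum_(k <- r) K k.
  move=> yV YK t at_; apply: (le_trans (ler_normD _ _)); apply: lerD;
    first exact: yV.
  rewrite mulN1r normrN; apply: (le_trans (ler_norm_sum _ _ _)).
  by rewrite big_seq [leRHS]big_seq; apply: ler_sum => k kr; exact: YK.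
have BPsi t : a <= t -> [/\ `|Psi t| <= V + \sum_(k <- r) K k,
    `|Psi1 t| <= V + \sum_(k <- r) K k & `|Psi2 t| <= V + \sum_(k <- r) K k].
  move=> at_; split; apply: BS => //.
  - by move=> x /B[].
  - by move=> k /rP /HT[_ H] x /H[].
  - by move=> x /B[].
  - by move=> k /rP /HT[_ H] x /H[].
  - by move=> x /B[].
  - by move=> k /rP /HT[_ H] x /H[].
have [P0 P1 P2] := third_order_Lq g10 g20 g30 (lexx 1) SPsi GL BPsi.
have [Q0 Q1 _] := SPsi; have c2 := third_order_hcont SPsi.
exists Th, Psi; split.
- move=> k km; have [qk1 Fk] := Fsmall k km; have [Sk Bk] := HT k km.
  have [L0 L1 L2] := third_order_Lq g10 g20 g30 qk1 Sk Fk Bk.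
  have [K0 K1 _] := Sk; have ck := third_order_hcont Sk.
  have k0 : k%:R != 0 :> R by rewrite pnatr_eq0 -lt0n; case/andP: km.
  rewrite inver (negPf k0) -EFinM.
  have qk0 : 0 < q / k%:R by lra.
  exact: (W2p_prim qk0 K0 K1 ck L0 L1 L2).
- exact: (W2p_prim (q := 1) ltr01 Q0 Q1 c2 P0 P1 P2).
move=> l l2 t at_; have [U0 U1 _] := S; have cu := third_order_hcont S.
rewrite (derivn_on_prim U0 U1 cu l2 at_) (derivn_on_prim Q0 Q1 c2 l2 at_).
have -> : \sum_(1 <= k < m.+1) derivn_on a l (Th k) t =
    \sum_(k <- r) nth (fun=> 0) [:: Th k; Th1 k; Th2 k] l t.
  rewrite big_seq [RHS]big_seq; apply: eq_bigr => k /rP /HT[Sk _].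
  by have [K0 K1 _] := Sk; exact: (derivn_on_prim K0 K1 (third_order_hcont Sk) l2
    at_).
case: l l2 => [_|l]; first by rewrite /= /Psi mulN1r addrC subrK.
case: l => [_|l]; first by rewrite /= /Psi1 mulN1r addrC subrK.
case: l => [_|l]; first by rewrite /= /Psi2 mulN1r addrC subrK.
by move=> l3; exfalso; move: l3; rewrite !ltnS ltn0.
Qed.

End decomposition.

(** * The polynomial equation *)

Section coefficients.
Context {R : realType}.
Local Notation mu := (@lebesgue_measure R).
Implicit Types (t : R) (x : 'I_3 -> R) (a : multi_index) (Omega : multi_index ->
  R -> R).

Lemma monomial_le a x (S : R) : (forall i, `|x i| <= S) ->
  `|\prod_(i < 3) x i ^+ a i| <= S ^+ mi_deg a.
Proof.
move=> xS; rewrite normr_prod /mi_deg -prodrXr; apply: ler_prod => i _.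
by rewrite normr_ge0 normrX lerXn2r ?nnegrE// (le_trans _ (xS i)).
Qed.

Lemma monomial_deg0 a x : mi_deg a = 0%N -> \prod_(i < 3) x i ^+ a i = 1.
Proof.
move=> /eqP; rewrite /mi_deg sum_nat_eq0 => /forallP a0.
by rewrite big1// => i _; have /eqP -> := a0 i; rewrite expr0.
Qed.

(* Since the degree-1 terms are products of two Lp functions, they are grouped
   with the quadratic ones. *)
Definition order_class a : nat := if mi_deg a == 0%N then 1 else maxn 2 (mi_deg a).

Lemma sum_order_class (X : multi_index -> R) :
  \sum_(a | (mi_deg a <= 4)%N) X a =
  \sum_(1 <= k < 5) \sum_(a | (mi_deg a <= 4)%N && (order_class a == k)) X a.
Proof.
have E a : (mi_deg a <= 4)%N ->
    \sum_(1 <= k < 5 | (mi_deg a <= 4)%N && (order_class a == k)) X a = X a.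
  move=> da; rewrite (eq_bigl (fun k => order_class a == k)); last by move=> k;
    rewrite da.
  rewrite big_mkcond /= 4?big_ltn// big_geq//= /order_class.
  by move: da; case: (mi_deg a) => [|[|[|[|[|]]]]]//= _; rewrite ?add0r ?addr0.
rewrite (exchange_big_dep (fun a => mi_deg a <= 4)%N)/=;
  last by move=> k a _ /andP[].
by apply: eq_bigr => a da; rewrite E.
Qed.

Lemma coef_le_abs_sum_from Omega a (k : nat) t : (k <= mi_deg a <= 4)%N ->
  `|Omega a t| <= abs_sum_from Omega k t.
Proof.
by move=> ka; rewrite /abs_sum_from (bigD1 a)//= lerDl; apply: sumr_ge0.
Qed.

Lemma subset_abs_sum_from (P : pred multi_index) Omega (k : nat) t :
  (forall a, P a -> (k <= mi_deg a <= 4)%N) ->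
  \sum_(a | P a) `|Omega a t| <= abs_sum_from Omega k t.
Proof.
move=> PQ; rewrite /abs_sum_from big_mkcond [leRHS]big_mkcond/=.
apply: ler_sum => a _; case: ifP => [/PQ ->//|_]; case: ifP => //.
Qed.

(** For q <= 4, m = ceil(q) - 1 means m < q <= m + 1, which separates the k with q / k >= 1 from
    those with F_k in L^1. For q > 4 the second range is empty. *)
Lemma num_terms_fin (q : R) : 1 < q -> let m := num_terms q%:E in
  [/\ (1 <= m <= 4)%N, forall k : nat, (1 <= k <= m)%N -> k%:R <= q &
    forall k : nat, (m < k <= 4)%N -> q <= k%:R].
Proof.
move=> q1; rewrite /num_terms lee_fin; case: leP => [q4|q4] /=; last first.
  split => // k; first by move=> /andP[_ k4]; rewrite ltW// (le_lt_trans _ q4)//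
    ler_nat.
  by move=> /andP[]; rewrite ltnNge => /negP.
have c2 : 1 < Num.ceil q by rewrite ceil_gt_int.
have c4 : Num.ceil q <= 4 by rewrite ceil_le_int.
have /andP[cl cr] := ceil_itv q.
have [n nE] : exists n : nat, Num.ceil q = n%:Z.
  by exists `|Num.ceil q|%N; rewrite gez0_abs// (le_trans _ (ltW c2)).
rewrite nE in c2 c4 cl cr *; rewrite absz_nat.
case: n nE c2 c4 cl cr => [//|[//|n]] nE _ c4 cl cr /=.
split.
- by move: c4; rewrite lez_nat => /ltnW.
- move=> k /andP[_ kn]; rewrite ltW// (le_lt_trans _ cl)//.
  have -> : (n.+2%:Z - 1 : int) = n.+1%:Z by rewrite -[n.+2]addn1 PoszD addrK.
  by rewrite -pmulrn ler_nat.
- by move=> k /andP[nk _]; apply: (le_trans cr); rewrite -pmulrn ler_nat.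
Qed.

End coefficients.

(** * The solution of the polynomial equation *)

Section main.
Context {R : realType}.
Local Notation mu := (@lebesgue_measure R).
Variables (t0 b0 b1 b2 g1 g2 g3 : R) (Omega : multi_index -> R -> R) (z : R -> R).
Hypotheses (g10 : g1 != 0) (g20 : g2 != 0) (g30 : g3 != 0).
Hypotheses (r1 : root (char_poly3 b0 b1 b2) g1) (r2 : root (char_poly3 b0 b1 b2) g2)
  (r3 : root (char_poly3 b0 b1 b2) g3).
Hypotheses (g12 : g2 < g1) (g23 : g3 < g2).
Hypotheses (zC : C02 t0 z) (zsol : ode_solution t0 b0 b1 b2 Omega z).
Local Notation z1 := (derivn_on t0 1 z).
Local Notation z2 := (derivn_on t0 2 z).
Local Notation sol := (third_order_solution g1 g2 g3).
Local Notation xz := (fun (t : R) (i : 'I_3) => derivn_on t0 i z t).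
Let S (t : R) := `|z t| + `|z1 t| + `|z2 t|.
Let X (a : multi_index) (t : R) := Omega a t * \prod_(i < 3) xz t i ^+ a i.

Lemma solution_bounded : exists V, 
  forall t, t0 <= t -> [/\ `|z t| <= V, `|z1 t| <= V & `|z2 t| <= V].
Proof.
have [P0 P1 c2] := C02_prim zC.
have [_ _ _ lim] := zC.
have [V0 H0] := hcont_cvg0_bounded (prim_hcont P0) (lim 0%N isT).
have [V1 H1] := hcont_cvg0_bounded (prim_hcont P1) (lim 1%N isT).
have [V2 H2] := hcont_cvg0_bounded c2 (lim 2%N isT).
exists (Num.max V0 (Num.max V1 V2)) => t tt.
by rewrite !le_max H0// H1// H2// !orbT.
Qed.

Lemma xz_le t i : `|xz t i| <= S t.
Proof.
rewrite /S; case: i => -[|[|[|//]]] /= _.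
- by rewrite -addrA lerDl addr_ge0.
- by rewrite addrAC lerDr addr_ge0.
- by rewrite lerDr addr_ge0.
Qed.

Lemma solution_small e : 0 < e -> exists2 T, t0 <= T & forall t, T <= t -> S t <= e.
Proof.
move=> e0; have e3 : 0 < e / 3 by lra.
have [_ _ _ lim] := zC.
have /cvgr0_norm_le /(_ _ e3) [T0 [_ H0]] := lim 0%N isT.
have /cvgr0_norm_le /(_ _ e3) [T1 [_ H1]] := lim 1%N isT.
have /cvgr0_norm_le /(_ _ e3) [T2 [_ H2]] := lim 2%N isT.
pose M := Num.max t0 (Num.max T0 (Num.max T1 T2)).
have MT : [/\ t0 <= M, T0 <= M, T1 <= M & T2 <= M].
  by rewrite /M !le_max !lexx !orbT.
case: MT => M0 M1 M2 M3.
exists (M + 1) => [|t Mt]; first by lra.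
have h0 : `|z t| <= e / 3 by apply: H0; lra.
have h1 : `|z1 t| <= e / 3 by apply: H1; lra.
have h2 : `|z2 t| <= e / 3 by apply: H2; lra.
rewrite /S; lra.
Qed.

Lemma derivn_hcont l : (l <= 2)%N -> hcont t0 (derivn_on t0 l z).
Proof.
have [P0 P1 c2] := C02_prim zC.
case: l => [_|l]; first exact: prim_hcont P0.
case: l => [_|l]; first exact: prim_hcont P1.
case: l => [_|l]; first exact: c2.
by move=> l3; exfalso; move: l3; rewrite !ltnS ltn0.
Qed.

Lemma term_measurable a : measurable_fun `[t0, +oo[ (Omega a) ->
  measurable_fun `[t0, +oo[ (X a).
Proof.
move=> mO; apply: measurable_funM => //.
apply: measurable_prod => i _.
have i2 : (i <= 2)%N by rewrite -ltnS.
exact: (measurable_funX (a i) (hcont_measurable (derivn_hcont i2))).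
Qed.

Lemma term_le a t : `|X a t| <= `|Omega a t| * S t ^+ mi_deg a.
Proof. by rewrite normrM ler_wpM2l// monomial_le// => i; exact: xz_le. Qed.

Lemma sum_measurable (P : pred multi_index) :
  (forall a, P a -> measurable_fun `[t0, +oo[ (Omega a)) ->
  measurable_fun `[t0, +oo[ (fun t => \sum_(a | P a) X a t).
Proof.
move=> mO.
apply: (eq_measurable_fun (fun t => \sum_a (if P a then X a t else 0))).
  by move=> t _; rewrite [RHS]big_mkcond.
have mX a : measurable_fun `[t0, +oo[ (fun t => if P a then X a t else 0).
  case Pa : (P a); last exact: measurable_cst.
  by apply: term_measurable; exact: mO.
exact: (measurable_sum (index_enum _) mX).
Qed.

Lemma solution_third_order :
  (forall a, (mi_deg a <= 4)%N -> measurable_fun `[t0, +oo[ (Omega a)) ->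
  sol t0 z z1 z2 (fun t => \sum_(a | (mi_deg a <= 4)%N) X a t).
Proof.
move=> mO.
have [P0 P1 c2] := C02_prim zC.
have [AC ode] := zsol.
have P2 : prim t0 z2 (derivn_on t0 3 z).
  split=> [T|t tt].
    have [T0|/ltW T0] := leP t0 T; first by have [] := AC T T0.
    apply: (itv_integrableW (lexx t0) T0); by have [] := AC t0 (lexx t0).
  by have [_ <-] := AC t tt; rewrite addrC subrK.
have n12 : g1 != g2 by rewrite gt_eqF.
have n23 : g2 != g3 by rewrite gt_eqF.
have n13 : g1 != g3 by rewrite gt_eqF// (lt_trans g23).
have [b2E b1E b0E] := char_poly3_coefs n12 n23 n13 r1 r2 r3.
split => //.
(* This is the derivative of v = (D - g2)(D - g3) z. By Vieta's formulas the equation says that it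
   equals g1 v plus the right-hand side almost everywhere. *)
have Pv := primD (primD P2 (primZ (- (g2 + g3)) P1)) (primZ (g2 * g3) P0).
have {}Pv : prim t0 (fun t => z2 t - (g2 + g3) * z1 t + g2 * g3 * z t)
    (fun t => derivn_on t0 3 z t + - (g2 + g3) * z2 t + g2 * g3 * z1 t).
  by apply: prim_eq Pv => t _ //; rewrite mulNr.
apply: prim_ae Pv _ _.
  apply: measurable_funD; last exact: sum_measurable.
  apply: hcont_measurable; apply: hcontZ.
  have c1 := prim_hcont P1; have c0 := prim_hcont P0.
  have H := hcontD (hcontD c2 (hcontZ (c := - (g2 + g3)) c1)) (hcontZ (c := g2 *
    g3) c0).
  by apply: hcont_eq H => t _; rewrite mulNr.
have AE : Filter (almost_everywhere mu) by exact: (ae_filter_ringOfSetsType mu).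
apply: filterS ode => t H tt; have {H} := H tt.
rewrite /poly_rhs -/(X _ t) => H.
have -> : derivn_on t0 3 z t =
  \sum_(a : multi_index | (mi_deg a <= 4)%N) X a t - (b2 * z2 t + b1 * z1 t + b0
    * z t).
  by rewrite /X -H; ring.
by rewrite b2E b1E b0E; ring.
Qed.

(** * Integrability and decomposition for finite p *)

Section finite_exponent.
Variables (c : sign_class) (q rho : R) (q1 : 1 < q).
Hypothesis (P2_1 : Lcal c g1 g2 g3 t0
  (fun s => \sum_(a : multi_index | mi_deg a == 1%N) `|Omega a s|) t @[t --> +oo]
    --> 0%E).
Hypothesis (small : forall s, t0 <= s -> abs_sum_from Omega 1 s <= rho).
Hypothesis (P3_0 : forall a, mi_deg a = 0%N -> Lp t0 q%:E (Omega a)).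
Variables (lambda_p lambda_c : multi_index -> R) (Omega_p : multi_index -> R -> R).
Hypothesis (P3_p : forall a, (1 <= mi_deg a <= 4)%N -> Lp t0 q%:E (Omega_p a)).
Hypothesis (P3_eq : forall a, (1 <= mi_deg a <= 4)%N -> forall t, t0 <= t ->
     Omega a t = lambda_p a * Omega_p a t + lambda_c a).

Lemma coef_measurable a : (mi_deg a <= 4)%N -> measurable_fun `[t0, +oo[ (Omega a).
Proof.
move=> a4; have [a0|a0] := posnP (mi_deg a); first by apply:
  Lp_measurable (P3_0 a0).
have a14 : (1 <= mi_deg a <= 4)%N by rewrite a0.
apply: (eq_measurable_fun (fun t => lambda_p a * Omega_p a t + lambda_c a)).
  by move=> t; rewrite inE/= in_itv/= andbT => tt; rewrite P3_eq.
apply: measurable_funD; last exact: measurable_cst.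
apply: measurable_funM; first exact: measurable_cst.
exact: Lp_measurable (P3_p a14).
Qed.

Lemma coef0_Lq a : mi_deg a = 0%N -> Lq_on t0 q (Omega a).
Proof. by move=> a0; have q0 : 0 < q by [exact: lt_trans q1];
  exact: (LpP t0 _ q0).1 (P3_0 a0). Qed.

Lemma coef1_Lq a : mi_deg a = 1%N -> Lq_on t0 q (Omega a).
Proof.
move=> a1; have q1' := ltW q1.
have a14 : (1 <= mi_deg a <= 4)%N by rewrite a1.
have gq : Lq_on t0 q (fun t => lambda_p a * Omega_p a t).
  by have q0 : 0 < q by [exact: lt_trans q1]; exact:
    Lq_onZ q1' ((LpP t0 _ q0).1 (P3_p a14)).
have lc : lambda_c a = 0.
  apply: (constant_part_eq0 g12 g23 q1' P2_1 _ (P3_eq a14) gq) => s _.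
  rewrite [leRHS]ger0_norm ?sumr_ge0// (bigD1 a) ?a1//= lerDl.
  exact: sumr_ge0.
by apply: Lq_on_eq gq => t tt; rewrite P3_eq// lc addr0.
Qed.

Lemma solution_Lq : [/\ Lq_on t0 q z, Lq_on t0 q z1 & Lq_on t0 q z2].
Proof.
have q1' := ltW q1; have [V BV] := solution_bounded.
have St0 t : 0 <= S t by rewrite /S !addr_ge0.
have SV t : t0 <= t -> S t <= 3 * V by move=> /BV[]; rewrite /S; lra.
have V0 : 0 <= V by have [H _ _] := BV t0 (lexx t0); exact: le_trans H.
have rho0 : 0 <= rho.
  by apply: le_trans (small (lexx t0)); rewrite /abs_sum_from sumr_ge0.
pose F t := \sum_(a | (mi_deg a <= 1)%N) X a t.
pose h t := \sum_(a | (2 <= mi_deg a <= 4)%N) X a t.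
apply: (third_order_small_perturbation g10 g20 g30 q1' (solution_third_order
  coef_measurable)
  (F := F) (h := h) _ _ _ _ BV).
- move=> t _; rewrite (bigID (fun a => (mi_deg a <= 1)%N))/=; congr (_ + _).
    by apply: eq_bigl => a; case: (mi_deg a) => [|[|[|[|[|]]]]].
  by apply: eq_bigl => a; case: (mi_deg a) => [|[|[|[|[|]]]]].
- apply: Lq_on_sum => // a a1.
  have a4 : (mi_deg a <= 4)%N by exact: leq_trans a1 _.
  apply: (Lq_on_mono (g := fun t => (3 * V) ^+ mi_deg a * Omega a t)) => //.
  + by apply: term_measurable; exact: coef_measurable.
  + move=> t tt; apply: (le_trans (term_le a t)); rewrite normrM mulrC ler_wpM2r//.
    rewrite ger0_norm; last by rewrite exprn_ge0// mulr_ge0.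
    by apply: lerXn2r; rewrite ?nnegrE// ?mulr_ge0// SV.
  + apply: Lq_onZ => //.
    by move: a1; case E : (mi_deg a) => [|[|//]] _;
      [exact: coef0_Lq|exact: coef1_Lq].
- by apply: sum_measurable => a /andP[_ a4]; exact: coef_measurable.
(* Once S <= d, a term of degree n >= 2 is at most |Omega| d S: one factor S is kept, one is bounded
   by d, and the other n - 2 by 1 as d <= 1. Summing gives rho d S <= e S. *)
- move=> e e0; pose d := Num.min 1 (e / (rho + 1)).
  have d0 : 0 < d by rewrite lt_min ltr01 divr_gt0//; lra.
  have [T t0T ST] := solution_small d0.
  exists T => // t Tt; rewrite -/(S t).
  have Sd := ST t Tt; have tt := le_trans t0T Tt.
  have S1 : S t <= 1 by apply: (le_trans Sd); rewrite ge_min lexx.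
  apply: (@le_trans _ _ (\sum_(a : multi_index | (2 <= mi_deg a <= 4)%N) `|Omega
    a t| * (d * S t))).
    apply: (le_trans (ler_norm_sum _ _ _)); apply: ler_sum => a /andP[a2 _].
    apply: (le_trans (term_le a t)); rewrite ler_wpM2l//.
    rewrite -(subnK a2) addnC exprD expr2 -mulrA.
    apply: ler_pM => //; first by rewrite mulr_ge0// exprn_ge0.
    by rewrite -[leRHS]mulr1 ler_wpM2l// exprn_ile1.
  rewrite -mulr_suml mulrA ler_wpM2r//.
  have : \sum_(a : multi_index | (2 <= mi_deg a <= 4)%N) `|Omega a t| <= rho.
    apply: le_trans (small tt); apply: subset_abs_sum_from => a /andP[a2 ->].
    by rewrite (leq_trans _ a2).
  have de : d * (rho + 1) <= e.
    by rewrite -ler_pdivlMr; [rewrite ge_min lexx orbT|lra].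
  have s0 : 0 <= \sum_(a : multi_index | (2 <= mi_deg a <= 4)%N) `|Omega a t| by
    rewrite sumr_ge0.
  by move: s0; set s := \sum_(a | _) _; nra.
Qed.

Lemma solution_decomposition : exists (Theta : nat -> R -> R) (Psi : R -> R),
    [/\ forall k : nat, (1 <= k <= num_terms q%:E)%N ->
      W2p t0 (q%:E / k%:R%:E)%E (Theta k),
        W2p t0 1%E Psi &
        forall l, (l <= 2)%N -> forall t, t0 <= t ->
          derivn_on t0 l z t =
            \sum_(1 <= k < (num_terms q%:E).+1) derivn_on t0 l (Theta k) t
            + derivn_on t0 l Psi t].
Proof.
have q1' := ltW q1; have q0 : 0 < q by exact: lt_trans q1.
have [V BV] := solution_bounded.
have St0 t : 0 <= S t by rewrite /S !addr_ge0.
have SV t : t0 <= t -> S t <= 3 * V by move=> /BV[]; rewrite /S; lra.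
have rho0 : 0 <= rho.
  by apply: le_trans (small (lexx t0)); rewrite /abs_sum_from sumr_ge0.
have [Z0 Z1 Z2] := solution_Lq.
have [m14 km mk] := num_terms_fin q1.
have normq f : Lq_on t0 q f -> Lq_on t0 q (fun t => `|f t|).
  move=> fq; apply: (Lq_on_mono q1' _ _ fq); last by move=> t _; rewrite normr_id.
  by apply: measurableT_comp => //; case: fq.
pose W t := \sum_(a : multi_index | mi_deg a == 1%N) `|Omega a t|.
(* A single function, bounded and in L^q, whose powers dominate all terms of positive degree: a term
   of degree 1 is at most W S <= H^2, one of degree k >= 2 at most rho H^k. The constant 1 + rho
   used below covers both cases. *)
pose H t := W t + S t.
have Wq : Lq_on t0 q W.
  by apply: Lq_on_sum; [exact: q1'|move=> a /eqP a1; exact: normq (coef1_Lq a1)].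
have Hq : Lq_on t0 q H.
  exact: (Lq_onD q1' Wq (Lq_onD q1' (Lq_onD q1' (normq _ Z0) (normq _ Z1)) (normq
    _ Z2))).
have W0 t : 0 <= W t by exact: sumr_ge0.
have HB t : t0 <= t -> 0 <= H t <= rho + 3 * V.
  move=> tt; rewrite addr_ge0//= lerD ?SV//.
  by apply: le_trans (small tt); apply: subset_abs_sum_from => a /eqP ->.
pose FF (k : nat) t := \sum_(a | (mi_deg a <= 4)%N && (order_class a == k)) X a t.
have SolF : sol t0 z z1 z2 (fun t => \sum_(1 <= k < 5) FF k t).
  by apply: third_order_eq (solution_third_order coef_measurable) => t _ //;
    exact: sum_order_class.
have high a k : (2 <= k)%N -> (mi_deg a <= 4)%N -> order_class a = k ->
    (k%:R <= q -> Lq_on t0 (q / k%:R) (X a)) /\ (q <= k%:R -> Lq_on t0 1 (X a)).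
  move=> k2 a4 ak.
  have k0 : (0 < k)%N by exact: leq_trans k2.
  have rho1 : 0 <= 1 + rho by lra.
  apply: (Lq_on_power q0 k0 rho1 Hq HB) => [|t tt].
    by apply: term_measurable; exact: coef_measurable.
  have /andP[H0 _] := HB t tt.
  have SH : S t <= H t by rewrite lerDr.
  apply: (le_trans (term_le a t)).
  move: ak; rewrite /order_class; case: ifP => [_ kE|/negbT];
    first by rewrite -kE in k2.
  rewrite -lt0n => a0 kE; move: kE; rewrite leq_eqVlt in a0.
  case/orP: a0 => [/eqP a1|a2].
    rewrite -a1 => <-; rewrite expr1 expr2.
    have OH : `|Omega a t| <= H t.
      rewrite /H /W (bigD1 a) -?a1//= -addrA lerDl addr_ge0//; exact: sumr_ge0.
    apply: (@le_trans _ _ (H t * H t)); first exact: ler_pM.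
    by rewrite ler_peMl ?mulr_ge0//; lra.
  have /maxn_idPr -> := a2 => <-.
  apply: ler_pM => //; first by rewrite exprn_ge0.
    apply: (@le_trans _ _ rho); last by lra.
    apply: le_trans (small tt); apply: coef_le_abs_sum_from.
    by rewrite a4 (leq_trans _ a2).
  by apply: lerXn2r; rewrite ?nnegrE.
apply: (third_order_decomposition g10 g20 g30 SolF m14 _ _ BV).
- move=> k kk; have kq := km k kk; have /andP[k1 _] := kk.
  have k0 : 0 < k%:R :> R by rewrite ltr0n.
  have qk : 1 <= q / k%:R by rewrite ler_pdivlMr// mul1r.
  split; first exact: qk.
  apply: Lq_on_sum; first exact: qk.
  move=> a /andP[a4 /eqP ak].
  have [k2|k2] := leqP 2 k; first by have [+ _] := high a k k2 a4 ak; apply.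
  have {k2}kE : k = 1%N by apply/eqP; rewrite eqn_leq k1 -ltnS k2.
  rewrite kE divr1; have a0 : mi_deg a = 0%N.
    move: ak; rewrite /order_class kE; case: eqP => // _.
    by move=> /eqP; rewrite eqn_leq geq_max.
  by apply: Lq_on_eq (coef0_Lq a0) => t _; rewrite /X monomial_deg0// mulr1.
- move=> k kk; have qk := mk k kk; case/andP: kk => kk _.
  apply: Lq_on_sum; first exact: lexx.
  move=> a /andP[a4 /eqP ak].
  have k2 : (2 <= k)%N by apply: leq_trans kk; case/andP: m14.
  by have [_ +] := high a k k2 a4 ak; apply.
Qed.

End finite_exponent.

Lemma solution_decomposition_oo : W2p t0 +oo%E z /\
  exists (Theta : nat -> R -> R) (Psi : R -> R),
    [/\ forall k : nat, (1 <= k <= 4)%N -> W2p t0 (+oo / k%:R%:E)%E (Theta k),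
        W2p t0 1%E Psi &
        forall l, (l <= 2)%N -> forall t, t0 <= t ->
          derivn_on t0 l z t =
            \sum_(1 <= k < 5) derivn_on t0 l (Theta k) t + derivn_on t0 l Psi t].
Proof.
have [V BV] := solution_bounded.
have [P0 P1 c2] := C02_prim zC.
have zoo := W2p_prim_oo P0 P1 c2 BV.
have P00 := prim_cst t0 (0 : R); have c0 := @hcont_cst R t0 0.
have L0 := @Lq_on0 R t0 1 (lexx 1).
have D0 l t : (l <= 2)%N -> t0 <= t -> derivn_on t0 l (fun=> 0 : R) t = 0.
  move=> l2 tt; rewrite (derivn_on_prim P00 P00 c0 l2 tt).
  by case: l l2 => [|[|[|]]].
(* Here p / k = +oo for every k, so z can serve as Theta_1, all other functions being zero. *)
split => //; exists (fun k => if k == 1%N then z else fun=> 0), (fun=> 0); split.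
- move=> k /andP[k1 _]; have k0 : (0 < k%:R^-1 :> R) by rewrite invr_gt0 ltr0n.
  rewrite inver pnatr_eq0 -[k == 0%N]negbK -lt0n k1/= mulyr gtr0_sg// mul1e.
  case: ifP => // _; apply: (W2p_prim_oo P00 P00 c0 (M := 0)) => t _.
  by rewrite normr0 lexx.
- exact: (W2p_prim (q := 1) ltr01 P00 P00 c0 L0 L0 L0).
- move=> l l2 t tt; rewrite big_ltn//= big_nat big1; last first.
    by move=> k /andP[k2 _]; rewrite gtn_eqF// D0.
  by rewrite D0// !addr0.
Qed.

End main.


Theorem theorem3p1 (R : realType) (t0 b0 b1 b2 : R)
  (Omega : multi_index -> R -> R) (p : \bar R) (p_gt1 : (1 < p)%E)
  (gamma1 gamma2 gamma3 : R) (c : sign_class)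
  (gamma_class : in_sign_class c gamma1 gamma2 gamma3)
  (P1_roots : [/\ root (char_poly3 b0 b1 b2) gamma1,
                  root (char_poly3 b0 b1 b2) gamma2 &
                  root (char_poly3 b0 b1 b2) gamma3])
  (P1_order : gamma1 > gamma2 /\ gamma2 > gamma3)
  (P2_0 : Gcal c gamma1 gamma2 gamma3 t0
            (fun s => \sum_(a : multi_index | mi_deg a == 0%N) Omega a s) t
          @[t --> +oo] --> 0)
  (P2_1 : Lcal c gamma1 gamma2 gamma3 t0
            (fun s => \sum_(a : multi_index | mi_deg a == 1%N) `|Omega a s|) t
          @[t --> +oo] --> 0%E)
  (P2_bounded : exists M : R, forall t, t0 <= t ->
     (\sum_(1 <= k < 5)
        Lcal c gamma1 gamma2 gamma3 t0 (abs_sum_from Omega k) t <= M%:E)%E)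
  (beta rho : R)
  (beta_adm : admissible c gamma1 gamma2 gamma3 beta)
  (rho_bounds : 0 < rho <
     (varsigma c gamma1 gamma2 gamma3 beta * A_hat gamma1 gamma2 gamma3)^-1)
  (small : forall s, t0 <= s -> abs_sum_from Omega 1 s <= rho)
  (P3_0 : forall a, mi_deg a = 0%N -> Lp t0 p (Omega a))
  (lambda_p lambda_c : multi_index -> R) (Omega_p : multi_index -> R -> R)
  (P3_p : forall a, (1 <= mi_deg a <= 4)%N -> Lp t0 p (Omega_p a))
  (P3_eq : forall a, (1 <= mi_deg a <= 4)%N -> forall t, t0 <= t ->
     Omega a t = lambda_p a * Omega_p a t + lambda_c a)
  (z : R -> R) (z_C02 : C02 t0 z) (z_sol : ode_solution t0 b0 b1 b2 Omega z) :
  W2p t0 p z /\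
  exists (Theta : nat -> R -> R) (Psi : R -> R),
    [/\ forall k, (1 <= k <= num_terms p)%N ->
          W2p t0 (p / k%:R%:E)%E (Theta k),
        W2p t0 1%E Psi &
        forall l, (l <= 2)%N -> forall t, t0 <= t ->
          derivn_on t0 l z t =
            \sum_(1 <= k < (num_terms p).+1) derivn_on t0 l (Theta k) t
            + derivn_on t0 l Psi t].
Proof.
case: P1_roots => r1 r2 r3; case: P1_order => g12 g23.
have [g10 g20 g30] : [/\ gamma1 != 0, gamma2 != 0 & gamma3 != 0].
  by move: gamma_class; case: (c) => -[h1 h2 h3];
    split; rewrite ?(lt_eqF h1) ?(lt_eqF h2) ?(lt_eqF h3)
                   ?(gt_eqF h1) ?(gt_eqF h2) ?(gt_eqF h3).
(* The value -oo is excluded by 1 < p; the case +oo is settled first. *)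
case: p p_gt1 P3_0 P3_p => [q||//] p1 h0 hp; last first.
  have -> : num_terms (+oo : \bar R) = 4%N by rewrite /num_terms leye_eq.
  exact: (solution_decomposition_oo z_C02).
have q1 : 1 < q by move: p1; rewrite lte_fin.
have q0 : 0 < q by exact: lt_trans q1.
split; last first.
  exact: (solution_decomposition g10 g20 g30 r1 r2 r3 g12 g23 z_C02 z_sol q1
    P2_1 small h0 hp P3_eq).
have [L0 L1 L2] := solution_Lq g10 g20 g30 r1 r2 r3 g12 g23 z_C02 z_sol q1
  P2_1 small h0 hp P3_eq.
have [P0 P1 c2] := C02_prim z_C02.
exact: (W2p_prim q0 P0 P1 c2 L0 L1 L2).
Qed.
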